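(* Let $\Bbbk$ be an algebraically closed field with $\operatorname{char}(\Bbbk)=0$. For all $\gamma\in\Bbbk^\times$, the line scheme $\mathfrak L(\gamma)\subset\mathbb P^5$ of the algebra $\mathcal A(\gamma)$ is a reduced scheme of degree twenty.
   Context: For $\gamma\in\Bbbk^\times$, $\mathcal A(\gamma)$ is the $\Bbbk$-algebra on generators $x_1,\dots,x_4$ with defining relations $x_4x_1=ix_1x_4$, $x_3^2=x_1^2$, $x_3x_1=x_1x_3-x_2^2$, $x_3x_2=ix_2x_3$, $x_4^2=x_2^2$, $x_4x_2=x_2x_4-\gamma x_1^2$, where $i\in\Bbbk$, $i^2=-1$. The homogeneous coordinates on $\mathbb P^5$ are the Plücker coordinates $M_{12},M_{13},M_{14},M_{23},M_{24},M_{34}$, and $P=M_{12}M_{34}-M_{13}M_{24}+M_{14}M_{23}$ is the Plücker polynomial. Line scheme as a closed subscheme of $\mathbb P^5$: let \[ \mathcal M(\gamma)=\begin{bmatrix} 0&u_1&0&0&0&v_1&0&0\\ u_2&0&0&0&v_2&0&0&0\\ 0&0&0&u_3&0&0&0&v_3\\ 0&0&u_4&0&0&0&v_4&0\\ u_3&0&u_1&0&v_3&0&v_1&0\\ 0&u_4&0&u_2&0&v_4&0&v_2\\ -u_4&0&0&iu_1&-v_4&0&0&iv_1\\ 0&-u_3&iu_2&0&0&-v_3&iv_2&0\\ u_1&0&u_3&\gamma u_2&v_1&0&v_3&\gamma v_2\\ 0&u_2&u_1&u_4&0&v_2&v_1&v_4 \end{bmatrix}. \] Each of its forty-five $8\times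 8$ minors can be written as a homogeneous quartic polynomial in the quantities $N_{ij}=u_iv_j-u_jv_i$, $1\le i<j\le 4$ (uniquely modulo the Plücker relation $N_{12}N_{34}-N_{13}N_{24}+N_{14}N_{23}=0$). Substituting $N_{12}\mapsto M_{34}$, $N_{13}\mapsto -M_{24}$, $N_{14}\mapsto M_{23}$, $N_{23}\mapsto M_{14}$, $N_{24}\mapsto -M_{13}$, $N_{34}\mapsto M_{12}$ gives forty-five quartic polynomials in the $M_{ij}$. The line scheme $\mathfrak L(\gamma)$ of $\mathcal A(\gamma)$ is the closed subscheme of $\mathbb P^5$ defined by these forty-five polynomials together with $P$. *)

(* Defs.v *)
From mathcomp Require Import all_boot all_order all_algebra.
From mathcomp Require Import mpoly.

Set Implicit Arguments.
Unset Strict Implicit.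
Unset Printing Implicit Defensive.

Import GRing.Theory.
Local Open Scope ring_scope.

Definition ideal_gen (A : comNzRingType) (G : A -> Prop) (f : A) : Prop :=
  exists s : seq (A * A),
    (forall c, c \in s -> G c.2) /\ f = \sum_(c <- s) c.1 * c.2.

(* A closed subscheme X of P^n is given by a homogeneous ideal I of
   S = K[x_0, .., x_n] defining it, X = Proj (S / I). *)
Section ProjectiveSubscheme.
Variables (K : fieldType) (n : nat).
Implicit Types (I : {mpoly K[n.+1]} -> Prop) (f g : {mpoly K[n.+1]}).

(* For g homogeneous of degree e > 0 and f homogeneous of degree k * e, this
   says that f / g ^ k is zero in O_X(D_+(g)) = (S / I)_(g). *)
Definition section_eq0 I g f : Prop := exists N : nat, I (g ^+ N * f).

(* X is reduced when no ring of sections has a nonzero nilpotent.  By the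
   sheaf property it is enough to consider the open sets D_+(g), which form a
   basis of the topology of X; the r-th power of the section f / g ^ k is
   f ^ r / g ^ (k * r). *)
Definition proj_reduced I : Prop :=
  forall (e : nat) (g : {mpoly K[n.+1]}), (0 < e)%N -> g \is e.-homog ->
  forall (k : nat) (f : {mpoly K[n.+1]}), f \is (k * e).-homog ->
  forall r : nat, section_eq0 I g (f ^+ r) -> section_eq0 I g f.

(* The graded piece (S / I)_m has dimension h. *)
Definition hilbert_value I (m h : nat) : Prop :=
  exists U : {vspace dhomog n.+1 K m},
    (forall f : dhomog n.+1 K m, f \in U <-> I (mpoly_of_dhomog f)) /\
    \dim (fullv : {vspace dhomog n.+1 K m}) = (\dim U + h)%N.

Definition hilbert_poly I (p : {poly rat}) : Prop :=
  exists m0 : nat, forall m : nat, (m0 <= m)%N ->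
  exists h : nat, hilbert_value I m h /\ p.[m%:R] = h%:R.

(* deg X is (dim X)! times the leading coefficient of the Hilbert polynomial,
   and dim X is the degree of that polynomial. *)
Definition proj_degree I (d : nat) : Prop :=
  exists p : {poly rat},
    hilbert_poly I p /\ lead_coef p * ((size p).-1)`!%:R = d%:R.

End ProjectiveSubscheme.

Section LineScheme.
Variable K : fieldType.

(* The six coordinates are ordered 12, 13, 14, 23, 24, 34. *)
Definition M12 : {mpoly K[6]} := 'X_(@Ordinal 6 0 isT).
Definition M13 : {mpoly K[6]} := 'X_(@Ordinal 6 1 isT).
Definition M14 : {mpoly K[6]} := 'X_(@Ordinal 6 2 isT).
Definition M23 : {mpoly K[6]} := 'X_(@Ordinal 6 3 isT).
Definition M24 : {mpoly K[6]} := 'X_(@Ordinal 6 4 isT).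
Definition M34 : {mpoly K[6]} := 'X_(@Ordinal 6 5 isT).

Definition plucker_poly : {mpoly K[6]} := M12 * M34 - M13 * M24 + M14 * M23.

Definition u1 : {mpoly K[8]} := 'X_(@Ordinal 8 0 isT).
Definition u2 : {mpoly K[8]} := 'X_(@Ordinal 8 1 isT).
Definition u3 : {mpoly K[8]} := 'X_(@Ordinal 8 2 isT).
Definition u4 : {mpoly K[8]} := 'X_(@Ordinal 8 3 isT).
Definition v1 : {mpoly K[8]} := 'X_(@Ordinal 8 4 isT).
Definition v2 : {mpoly K[8]} := 'X_(@Ordinal 8 5 isT).
Definition v3 : {mpoly K[8]} := 'X_(@Ordinal 8 6 isT).
Definition v4 : {mpoly K[8]} := 'X_(@Ordinal 8 7 isT).

Definition line_mx (i gamma : K) : 'M[{mpoly K[8]}]_(10, 8) :=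
  \matrix_(r < 10, c < 8) nth 0 (nth [::]
   [:: [::    0;    u1;       0;           0;    0;    v1;       0;           0];
       [::   u2;     0;       0;           0;   v2;     0;       0;           0];
       [::    0;     0;       0;          u3;    0;     0;       0;          v3];
       [::    0;     0;      u4;           0;    0;     0;      v4;           0];
       [::   u3;     0;      u1;           0;   v3;     0;      v1;           0];
       [::    0;    u4;       0;          u2;    0;    v4;       0;          v2];
       [:: - u4;     0;       0;     i *: u1; - v4;     0;       0;     i *: v1];
       [::    0;  - u3; i *: u2;           0;    0;  - v3; i *: v2;           0];
       [::   u1;     0;      u3; gamma *: u2;   v1;     0;      v3; gamma *: v2];
       [::    0;    u2;      u1;          u4;    0;    v2;      v1;          v4]]
   r) c.

(* N_ij = u_i v_j - u_j v_i *)
Definition N_uv : 6.-tuple {mpoly K[8]} :=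
  [tuple u1 * v2 - u2 * v1; u1 * v3 - u3 * v1; u1 * v4 - u4 * v1;
         u2 * v3 - u3 * v2; u2 * v4 - u4 * v2; u3 * v4 - u4 * v3].

Definition N_to_M : 6.-tuple {mpoly K[6]} :=
  [tuple M34; - M24; M23; M14; - M13; M12].

(* An 8 x 8 minor is given by an increasing choice s of eight rows.  The
   quartic Q in the N_ij representing a minor is unique only modulo the
   Plucker relation, which N_to_M sends to plucker_poly: as plucker_poly is a
   generator, admitting every such Q does not change the ideal. *)
Definition line_scheme_generator (i gamma : K) (F : {mpoly K[6]}) : Prop :=
  F = plucker_poly \/
  exists (s : 'I_8 -> 'I_10) (Q : {mpoly K[6]}),
    [/\ {homo s : a b / (a < b)%N}, Q \is 4.-homog,
        Q \mPo N_uv = \det (rowsub s (line_mx i gamma))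
      & F = Q \mPo N_to_M].

Definition line_scheme_ideal (i gamma : K) : {mpoly K[6]} -> Prop :=
  ideal_gen (line_scheme_generator i gamma).

End LineScheme.

(* Main.v *)
Require Import Defs.
From mathcomp Require Import all_boot all_order all_algebra.
From mathcomp Require Import mpoly zify ring.

Set Implicit Arguments.
Unset Strict Implicit.
Unset Printing Implicit Defensive.

Import GRing.Theory.
Local Open Scope ring_scope.

(** Write a, b, c, d, e, f for M12, M13, M14, M23, M24, M34.  Modulo the ideal I,
every monomial of degree m >= 4 is a combination of the 20 m - 20 monomials
w y^s z^t of degree m, where w is one of 1, a, a^2, f, f^2, and y, z are two of
the variables b, c, d, e, in one of 20 combinations of w with {y, z}.  For each
of the six pairs {y, z} the line scheme contains a curve on which the other two
of b, c, d, e vanish: a plane cubic for de, bc, ce, bd, a space quartic for cd,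
a pair of conics for be.  The curve is finite over the line with coordinates
(y : z), and the monomials w combined with {y, z} are linearly independent on
its generic fibre.  Hence a combination of the above monomials that vanishes on
these curves is zero.  So in degrees m >= 4 the ideal I consists of all forms
vanishing on the curves, which gives reducedness, and the Hilbert polynomial is
20 m - 20. *)

(** * Sparse polynomials *)

(** Spanning comes from rewriting alone and independence from points alone. That the rewriting is
    confluent and that the six curves exhaust the line scheme are consequences, not inputs. A rule
    whose leading monomial is free of a and f has no other monomial. So I contains bcde and every
    b^2cd, bc^2d, .., cde^2, and at a point of the line scheme at most two of b, c, d, e are
    nonzero: this is the origin of the six pairs. The Plücker relation af = be - cd keeps products
    of a and f out of w. The number of w combined with {y, z} is the number of points in a generic
    fibre of the curve: 3 for each of the four cubics, 4 for each of the other two curves, 20 in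
    all. The bound 4 is the degree of the minors. In degree 3 the ideal has only the multiples of
    the Plücker polynomial, so the quotient has dimension 56 - 6 = 50 instead of 40. *)

Definition spoly := seq (int * seq nat).

(** Missing trailing exponents count as 0, so that [[::]] is the monomial 1 in any number of
    variables. *)
Fixpoint expo_add (e f : seq nat) : seq nat :=
  match e, f with
  | m :: e', n :: f' => (m + n)%N :: expo_add e' f'
  | [::], _ => f
  | _, [::] => e
  end.

Definition sone : spoly := [:: (1, [::])].

Definition sopp (p : spoly) : spoly := [seq (- t.1, t.2) | t <- p].

Definition smul (p q : spoly) : spoly :=
  [seq (s.1 * t.1, expo_add s.2 t.2) | s <- p, t <- q].

(** Exponent lists are compared literally, so lists differing by trailing zeros stay apart. This
    could make a zero test fail, but never succeed wrongly. *)
Fixpoint sinsert (t : int * seq nat) (p : spoly) : spoly :=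
  if p is s :: p' then
    if t.2 == s.2 then (t.1 + s.1, s.2) :: p' else s :: sinsert t p'
  else [:: t].

Definition scollect (p : spoly) : spoly :=
  [seq t <- foldr sinsert [::] p | t.1 != 0].

(* Here the first variable is a square root of -1. *)
Definition sreduce (p : spoly) : spoly :=
  [seq if t.2 is n :: e then ((-1) ^+ n./2 * t.1, (odd n : nat) :: e) else t
  | t <- p].

Fixpoint ssubst_mon (subs : seq spoly) (e : seq nat) : spoly :=
  match subs, e with
  | q :: subs', n :: e' => iter n (smul q) (ssubst_mon subs' e')
  | _, _ => sone
  end.

Definition ssubst (subs : seq spoly) (p : spoly) : spoly :=
  flatten [seq smul [:: (t.1, [::])] (ssubst_mon subs t.2) | t <- p].

Definition delete_nth (T : Type) (j : nat) (s : seq T) :=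
  take j s ++ drop j.+1 s.

(** Expansion along the first row. The test for an empty entry comes before the recursive call, so
    that [vm_compute] never expands the cofactor of a zero entry; the matrix is sparse enough for
    this to make all 45 minors feasible. *)
Fixpoint sdet (n : nat) (M : seq (seq spoly)) : spoly :=
  if n is n'.+1 then
    scollect (flatten
      [seq if nth [::] (head [::] M) j is [::] then [::] else
           smul [:: ((-1) ^+ j, [::])]
             (smul (nth [::] (head [::] M) j)
                   (sdet n' [seq delete_nth j r | r <- behead M]))
      | j <- iota 0 n'.+1])
  else sone.

Section Evaluation.
Variable A : comNzRingType.
Implicit Types (env : seq A) (p q : spoly).

Fixpoint mon_eval env (e : seq nat) : A :=
  match env, e with
  | x :: env', n :: e' => x ^+ n * mon_eval env' e'
  | _, _ => 1
  end.

Definition seval env p : A := \sum_(t <- p) t.1%:~R * mon_eval env t.2.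

Lemma mon_evalD env e f :
  mon_eval env (expo_add e f) = mon_eval env e * mon_eval env f.
Proof.
elim: env e f => [|x env IH] [|m e] [|n f] //=; rewrite ?mul1r ?mulr1 //.
by rewrite exprD IH mulrACA.
Qed.

Lemma mon_eval_nil env : mon_eval env [::] = 1.
Proof. by case: env. Qed.

Lemma seval_nil env : seval env [::] = 0.
Proof. exact: big_nil. Qed.

Lemma seval_cons env t p :
  seval env (t :: p) = t.1%:~R * mon_eval env t.2 + seval env p.
Proof. exact: big_cons. Qed.

Lemma seval_cat env p q : seval env (p ++ q) = seval env p + seval env q.
Proof. exact: big_cat. Qed.

Lemma seval_flatten env (s : seq spoly) :
  seval env (flatten s) = \sum_(p <- s) seval env p.
Proof. exact: big_flatten. Qed.

Lemma seval_const env c : seval env [:: (c, [::])] = c%:~R.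
Proof. by rewrite seval_cons seval_nil mon_eval_nil mulr1 addr0. Qed.

Lemma seval_one env : seval env sone = 1.
Proof. exact: seval_const. Qed.

Lemma seval_opp env p : seval env (sopp p) = - seval env p.
Proof.
rewrite /seval big_map -sumrN; apply: eq_bigr => t _ /=.
by rewrite rmorphN mulNr.
Qed.

Lemma seval_mul env p q : seval env (smul p q) = seval env p * seval env q.
Proof.
rewrite /seval big_allpairs_dep mulr_suml; apply: eq_bigr => s _.
rewrite mulr_sumr; apply: eq_bigr => t _ /=.
by rewrite mon_evalD rmorphM mulrACA.
Qed.

Lemma seval_insert env t p :
  seval env (sinsert t p) = t.1%:~R * mon_eval env t.2 + seval env p.
Proof.
elim: p => [|s p IH] /=; first by rewrite seval_cons.
case: eqP => [->|_]; rewrite !seval_cons /=.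
  by rewrite rmorphD mulrDl addrA.
by rewrite IH addrCA.
Qed.

Lemma seval_collect env p : seval env (scollect p) = seval env p.
Proof.
have -> : seval env p = seval env (foldr sinsert [::] p).
  by elim: p => //= t p IH; rewrite seval_insert seval_cons IH.
rewrite /seval big_filter [RHS](bigID (fun t => t.1 != 0)) /=.
rewrite [X in _ + X]big1 ?addr0 // => t /negPn/eqP ->.
by rewrite mul0r.
Qed.

Lemma seval_reduce x env p :
  x ^+ 2 = -1 -> seval (x :: env) (sreduce p) = seval (x :: env) p.
Proof.
move=> x2; rewrite /seval big_map; apply: eq_bigr => -[c [|n e]] _ //=.
rewrite rmorphM rmorphXn rmorphN1 !mulrA; congr (_ * _).
rewrite mulrAC [RHS]mulrC; congr (_ * _).
by rewrite -x2 -exprM -exprD mul2n addnC odd_double_half.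
Qed.

Lemma seval_subst_mon env subs e :
  seval env (ssubst_mon subs e) = mon_eval (map (seval env) subs) e.
Proof.
elim: subs e => [|q subs IH] [|n e] /=; rewrite ?seval_one //.
elim: n => [|n IHn] /=; first by rewrite IH mul1r.
by rewrite seval_mul IHn mulrA -exprS.
Qed.

Lemma seval_subst env subs p :
  seval env (ssubst subs p) = seval (map (seval env) subs) p.
Proof.
rewrite seval_flatten big_map; apply: eq_bigr => t _.
by rewrite seval_mul seval_const seval_subst_mon.
Qed.

Lemma nth_delete_nth (T : Type) (x : T) j s k :
  nth x (delete_nth j s) k = nth x s (bump j k).
Proof.
rewrite /delete_nth nth_cat size_take /bump.
case: (ltnP j (size s)) => [lt_js|le_sj].
  case: (ltnP k j) => [lt_kj|le_jk].
    by rewrite nth_take // add0n.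
  by rewrite nth_drop add1n addSn subnKC.
case: (ltnP k (size s)) => [lt_ks|le_sk].
  by rewrite nth_take ?(leq_trans lt_ks) // leqNgt (leq_trans lt_ks).
rewrite !nth_default //; first by rewrite (leq_trans le_sk) ?leq_addl.
by rewrite size_drop (leq_trans _ (leq0n _)) // leqn0 subn_eq0 ltnW.
Qed.

Lemma seval_det env n (M : seq (seq spoly)) :
  seval env (sdet n M) =
  \det (\matrix_(i < n, j < n) seval env (nth [::] (nth [::] M i) j)).
Proof.
elim: n M => [|n IH] M; first by rewrite seval_one det_mx00.
rewrite (expand_det_row _ ord0) /sdet -/sdet seval_collect seval_flatten.
rewrite big_map -[iota 0 n.+1]/(index_iota 0 n.+1) big_mkord.
apply: eq_bigr => j _; rewrite mxE /cofactor add0n.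
have -> : row' ord0 (col' j
    (\matrix_(i0 < n.+1, j0 < n.+1) seval env (nth [::] (nth [::] M i0) j0))) =
    \matrix_(i0 < n, j0 < n) seval env
      (nth [::] (nth [::] [seq delete_nth j r | r <- behead M] i0) j0).
  apply/matrixP => i0 j0; rewrite !mxE; congr (seval _ _).
  have nthM k : nth [::] [seq delete_nth j r | r <- behead M] k =
                delete_nth j (nth [::] M k.+1).
    rewrite -nth_behead; case: (ltnP k (size (behead M))) => [ltk|lek].
      exact: nth_map.
    by rewrite !nth_default ?size_map.
  by rewrite nthM nth_delete_nth /=.
rewrite -IH -nth0 /=.
have E : seval env (smul [:: ((-1) ^+ j, [::])]
  (smul (nth [::] (nth [::] M 0) j) 
     (sdet n [seq delete_nth j r | r <- behead M]))) =
  seval env (nth [::] (nth [::] M 0) j) * ((-1) ^+ j *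
     seval env (sdet n [seq delete_nth j r | r <- behead M])).
  by rewrite !seval_mul seval_const rmorphXn rmorphN1 mulrCA.
by rewrite -E; case: (nth [::] (nth [::] M 0) j).
Qed.

End Evaluation.

Lemma rmorph_seval (A B : comNzRingType) (phi : {rmorphism A -> B})
    (env : seq A) p : phi (seval env p) = seval (map phi env) p.
Proof.
rewrite rmorph_sum; apply: eq_bigr => t _; rewrite rmorphM rmorph_int.
congr (_ * _); elim: env t.2 => [|x env IH] [|n e] /=; rewrite ?rmorph1 //.
by rewrite rmorphM rmorphXn IH.
Qed.

(** * The minors *)

(** [tm], [minor], [term] and [rule] are pairs and triples under a name; they fix the scope in which
    the numerals of the tables are read. *)
Definition tm (c : int) (e : seq nat) : int * seq nat := (c, e).
Arguments tm c%_Z e%_N.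

Definition minor (r r' : nat) (Q : spoly) := (r, r', Q).
Arguments minor (r r')%_N Q.

Definition term (c : int) (e : seq nat) (k : nat) := (c, e, k).
Arguments term c%_Z e%_N k%_N.

Definition rule (L : seq nat) (cert : seq (int * seq nat * nat)) (q : spoly) :=
  (L, cert, q).
Arguments rule L%_N cert q.

(* [minor r r' Q]: Q represents the minor omitting the rows r and r'.  The
   exponents are those of i, gamma, N12, N13, N14, N23, N24, N34. *)
Definition minor_data : seq (nat * nat * spoly) :=
  [:: minor 0 1 [:: tm (-1) [:: 0; 0; 2; 0; 0; 0; 0; 2];
    tm 2 [:: 0; 0; 1; 1; 0; 0; 1; 1]; tm 1 [:: 0; 1; 1; 0; 0; 0; 0; 3];
    tm 1 [:: 1; 0; 0; 2; 1; 0; 0; 1]; tm (-2) [:: 0; 0; 0; 2; 0; 0; 2; 0];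
    tm (-1) [:: 0; 1; 0; 1; 0; 0; 1; 2]; tm 1 [:: 0; 0; 0; 0; 2; 0; 0; 2];
    tm 1 [:: 0; 0; 0; 0; 0; 2; 0; 2]; tm (-1) [:: 1; 1; 0; 0; 0; 1; 2; 1];
    tm (-1) [:: 0; 0; 0; 0; 0; 0; 0; 4]];
     minor 0 2 [:: tm (-1) [:: 1; 0; 3; 0; 0; 0; 0; 1];
       tm 1 [:: 1; 0; 2; 1; 0; 0; 1; 0]; tm 1 [:: 1; 1; 2; 0; 0; 0; 0; 2];
       tm (-1) [:: 1; 1; 1; 1; 0; 0; 1; 1]; tm 1 [:: 1; 0; 1; 0; 2; 0; 0; 1];
       tm 1 [:: 1; 0; 1; 0; 0; 2; 0; 1]; tm 1 [:: 0; 1; 1; 0; 0; 1; 2; 0];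
       tm (-1) [:: 1; 0; 1; 0; 0; 0; 0; 3]; tm 1 [:: 1; 0; 0; 1; 0; 0; 1; 2];
       tm (-1) [:: 0; 1; 0; 0; 1; 0; 2; 1]];
     minor 0 3 [:: tm 1 [:: 0; 0; 2; 1; 0; 0; 1; 0];
       tm 1 [:: 1; 1; 1; 0; 0; 1; 2; 0]; tm 1 [:: 1; 0; 0; 2; 0; 1; 0; 1];
       tm (-2) [:: 0; 0; 0; 1; 0; 2; 1; 0]; tm 1 [:: 0; 0; 0; 1; 0; 0; 1; 2]];
     minor 0 4 [:: tm 1 [:: 1; 0; 1; 1; 1; 0; 0; 1];
       tm (-1) [:: 0; 0; 1; 1; 0; 0; 2; 0]; tm 1 [:: 0; 1; 1; 0; 0; 0; 1; 2];
       tm (-1) [:: 0; 1; 0; 1; 0; 0; 2; 1]; tm 1 [:: 0; 0; 0; 0; 0; 2; 1; 1];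
       tm (-1) [:: 1; 1; 0; 0; 0; 1; 3; 0];
       tm (-1) [:: 0; 0; 0; 0; 0; 0; 1; 3]];
     minor 0 5 [:: tm (-1) [:: 1; 0; 2; 1; 0; 0; 0; 1];
       tm 1 [:: 1; 0; 1; 2; 0; 0; 1; 0]; tm 1 [:: 0; 1; 1; 0; 0; 1; 1; 1];
       tm 1 [:: 1; 0; 0; 1; 0; 2; 0; 1]; tm (-1) [:: 0; 1; 0; 1; 0; 1; 2; 0]];
     minor 0 6 [:: tm (-1) [:: 0; 0; 2; 0; 0; 1; 0; 1];
       tm 1 [:: 0; 0; 1; 1; 0; 1; 1; 0]; tm (-1) [:: 0; 0; 1; 0; 1; 0; 0; 2];
       tm 1 [:: 0; 1; 1; 0; 0; 1; 0; 2]; tm (-1) [:: 0; 1; 0; 1; 0; 1; 1; 1];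
       tm 1 [:: 0; 0; 0; 0; 0; 3; 0; 1]; tm (-1) [:: 1; 1; 0; 0; 0; 2; 2; 0];
       tm (-1) [:: 0; 0; 0; 0; 0; 1; 0; 3]];
     minor 0 7 [:: tm 1 [:: 1; 0; 1; 1; 1; 0; 1; 0];
       tm 1 [:: 0; 1; 1; 0; 0; 0; 2; 1]; tm 1 [:: 1; 0; 0; 1; 0; 1; 1; 1];
       tm (-1) [:: 0; 1; 0; 1; 0; 0; 3; 0]];
     minor 0 8 [:: tm (-1) [:: 1; 0; 1; 1; 0; 0; 0; 2];
       tm 1 [:: 0; 0; 1; 0; 0; 1; 1; 1]; tm 1 [:: 1; 0; 0; 2; 0; 0; 1; 1];
       tm (-2) [:: 0; 0; 0; 1; 0; 1; 2; 0]; tm 1 [:: 0; 0; 0; 0; 1; 0; 1; 2]];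
     minor 0 9 [:: tm 1 [:: 1; 0; 1; 1; 1; 0; 0; 1];
       tm 1 [:: 0; 1; 1; 0; 0; 0; 1; 2]; tm 1 [:: 1; 0; 0; 1; 0; 1; 0; 2];
       tm (-1) [:: 0; 1; 0; 1; 0; 0; 2; 1]];
     minor 1 2 [:: tm (-1) [:: 0; 0; 2; 1; 0; 0; 1; 0];
       tm 1 [:: 1; 0; 1; 2; 1; 0; 0; 0]; tm 2 [:: 0; 0; 0; 1; 2; 0; 1; 0];
       tm (-1) [:: 0; 0; 0; 1; 0; 0; 1; 2]; tm 1 [:: 1; 1; 0; 0; 1; 0; 2; 1]];
     minor 1 3 [:: tm 1 [:: 1; 0; 3; 0; 0; 0; 0; 1];
       tm (-1) [:: 1; 0; 2; 1; 0; 0; 1; 0]; tm (-1) [:: 1; 1; 2; 0; 0; 0; 0; 2];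
       tm 1 [:: 0; 0; 1; 2; 1; 0; 0; 0]; tm 1 [:: 1; 1; 1; 1; 0; 0; 1; 1];
       tm (-1) [:: 1; 0; 1; 0; 2; 0; 0; 1]; tm (-1) [:: 1; 0; 1; 0; 0; 2; 0; 1];
       tm 1 [:: 1; 0; 1; 0; 0; 0; 0; 3]; tm (-1) [:: 0; 0; 0; 2; 0; 1; 0; 1];
       tm (-1) [:: 1; 0; 0; 1; 0; 0; 1; 2]];
     minor 1 4 [:: tm (-1) [:: 1; 0; 2; 0; 0; 0; 1; 1];
       tm (-1) [:: 0; 0; 1; 1; 1; 0; 0; 1]; tm 1 [:: 1; 0; 1; 1; 0; 0; 2; 0];
       tm 1 [:: 0; 0; 0; 2; 1; 0; 1; 0]; tm 1 [:: 1; 0; 0; 0; 2; 0; 1; 1]];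
     minor 1 5 [:: tm (-1) [:: 0; 0; 1; 2; 0; 0; 1; 0];
       tm 1 [:: 0; 1; 1; 1; 0; 0; 0; 2]; tm (-1) [:: 1; 1; 1; 0; 0; 1; 1; 1];
       tm 1 [:: 1; 0; 0; 3; 1; 0; 0; 0]; tm (-1) [:: 0; 1; 0; 2; 0; 0; 1; 1];
       tm 1 [:: 0; 0; 0; 1; 2; 0; 0; 1]; tm (-1) [:: 0; 0; 0; 1; 0; 0; 0; 3]];
     minor 1 6 [:: tm (-1) [:: 0; 0; 1; 2; 0; 0; 0; 1];
       tm 1 [:: 1; 0; 1; 1; 0; 1; 1; 0]; tm 1 [:: 0; 0; 0; 3; 0; 0; 1; 0];
       tm 1 [:: 1; 0; 0; 1; 1; 0; 1; 1]];
     minor 1 7 [:: tm (-1) [:: 0; 0; 2; 0; 1; 0; 0; 1];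
       tm 1 [:: 0; 0; 1; 1; 1; 0; 1; 0]; tm 1 [:: 0; 1; 1; 0; 1; 0; 0; 2];
       tm (-1) [:: 0; 0; 1; 0; 0; 1; 0; 2]; tm 1 [:: 1; 0; 0; 2; 2; 0; 0; 0];
       tm (-1) [:: 0; 1; 0; 1; 1; 0; 1; 1]; tm 1 [:: 0; 0; 0; 0; 3; 0; 0; 1];
       tm (-1) [:: 0; 0; 0; 0; 1; 0; 0; 3]];
     minor 1 8 [:: tm 1 [:: 0; 0; 1; 1; 0; 0; 0; 2];
       tm (-1) [:: 1; 0; 1; 0; 0; 1; 1; 1]; tm (-1) [:: 0; 0; 0; 2; 0; 0; 1; 1];
       tm (-1) [:: 1; 0; 0; 0; 1; 0; 1; 2]];
     minor 1 9 [:: tm (-1) [:: 0; 0; 1; 1; 1; 0; 0; 1];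
       tm (-1) [:: 1; 1; 1; 0; 0; 0; 1; 2]; tm 2 [:: 0; 0; 0; 2; 1; 0; 1; 0];
       tm (-1) [:: 0; 0; 0; 1; 0; 1; 0; 2]; tm 1 [:: 1; 1; 0; 1; 0; 0; 2; 1]];
     minor 2 3 [:: tm (-1) [:: 0; 0; 4; 0; 0; 0; 0; 0];
       tm 1 [:: 0; 1; 3; 0; 0; 0; 0; 1]; tm (-1) [:: 0; 1; 2; 1; 0; 0; 1; 0];
       tm 1 [:: 0; 0; 2; 0; 2; 0; 0; 0]; tm 1 [:: 0; 0; 2; 0; 0; 2; 0; 0];
       tm (-1) [:: 0; 0; 2; 0; 0; 0; 0; 2]; tm (-1) [:: 1; 0; 1; 2; 0; 1; 0; 0];
       tm 2 [:: 0; 0; 1; 1; 0; 0; 1; 1]; tm 1 [:: 1; 1; 1; 0; 1; 0; 2; 0];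
       tm (-2) [:: 0; 0; 0; 2; 0; 0; 2; 0]];
     minor 2 4 [:: tm 1 [:: 0; 0; 3; 0; 0; 0; 1; 0];
       tm (-1) [:: 1; 0; 2; 1; 1; 0; 0; 0]; tm (-1) [:: 0; 0; 1; 0; 2; 0; 1; 0];
       tm 1 [:: 0; 0; 0; 1; 0; 0; 2; 1]; tm (-1) [:: 1; 1; 0; 0; 1; 0; 3; 0]];
     minor 2 5 [:: tm 1 [:: 1; 1; 2; 1; 0; 0; 0; 1];
       tm 1 [:: 0; 1; 2; 0; 0; 1; 1; 0]; tm (-1) [:: 1; 1; 1; 2; 0; 0; 1; 0];
       tm 1 [:: 1; 0; 1; 1; 2; 0; 0; 0]; tm (-1) [:: 1; 0; 1; 1; 0; 0; 0; 2];
       tm 1 [:: 1; 0; 0; 2; 0; 0; 1; 1]; tm (-1) [:: 0; 1; 0; 1; 1; 0; 2; 0]];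
     minor 2 6 [:: tm 1 [:: 0; 0; 1; 1; 1; 0; 1; 0];
       tm 1 [:: 1; 1; 1; 0; 0; 0; 2; 1]; tm 1 [:: 0; 0; 0; 1; 0; 1; 1; 1];
       tm (-1) [:: 1; 1; 0; 1; 0; 0; 3; 0]];
     minor 2 7 [:: tm (-1) [:: 1; 0; 3; 0; 1; 0; 0; 0];
       tm 1 [:: 1; 1; 2; 0; 1; 0; 0; 1]; tm (-1) [:: 1; 0; 2; 0; 0; 1; 0; 1];
       tm (-1) [:: 1; 1; 1; 1; 1; 0; 1; 0]; tm 1 [:: 1; 0; 1; 0; 3; 0; 0; 0];
       tm (-1) [:: 1; 0; 1; 0; 1; 0; 0; 2]; tm 1 [:: 1; 0; 0; 1; 1; 0; 1; 1];
       tm (-1) [:: 0; 1; 0; 0; 2; 0; 2; 0]];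
     minor 2 8 [:: tm 1 [:: 1; 0; 2; 1; 0; 0; 0; 1];
       tm 1 [:: 0; 0; 2; 0; 0; 1; 1; 0]; tm (-1) [:: 1; 0; 1; 2; 0; 0; 1; 0];
       tm 1 [:: 0; 0; 1; 0; 1; 0; 1; 1]; tm (-2) [:: 0; 0; 0; 1; 1; 0; 2; 0]];
     minor 2 9 [:: tm (-1) [:: 1; 0; 2; 1; 1; 0; 0; 0];
       tm 1 [:: 0; 1; 2; 0; 0; 0; 1; 1]; tm (-1) [:: 1; 0; 1; 1; 0; 1; 0; 1];
       tm (-1) [:: 0; 1; 1; 1; 0; 0; 2; 0]];
     minor 3 4 [:: tm (-1) [:: 0; 0; 2; 1; 1; 0; 0; 0];
       tm 1 [:: 1; 1; 2; 0; 0; 0; 1; 1]; tm (-1) [:: 1; 1; 1; 1; 0; 0; 2; 0];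
       tm 1 [:: 1; 0; 1; 0; 0; 2; 1; 0]; tm (-1) [:: 1; 0; 1; 0; 0; 0; 1; 2];
       tm 1 [:: 0; 0; 0; 2; 0; 1; 1; 0]; tm 1 [:: 1; 0; 0; 1; 0; 0; 2; 1]];
     minor 3 5 [:: tm 1 [:: 0; 0; 3; 1; 0; 0; 0; 0];
       tm 1 [:: 1; 1; 2; 0; 0; 1; 1; 0]; tm (-1) [:: 0; 0; 1; 1; 0; 2; 0; 0];
       tm 1 [:: 1; 0; 0; 3; 0; 1; 0; 0]; tm 1 [:: 0; 0; 0; 2; 0; 0; 1; 1]];
     minor 3 6 [:: tm (-1) [:: 1; 0; 3; 0; 0; 1; 0; 0];
       tm (-1) [:: 1; 0; 2; 0; 1; 0; 0; 1]; tm 1 [:: 1; 1; 2; 0; 0; 1; 0; 1];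
       tm (-1) [:: 1; 1; 1; 1; 0; 1; 1; 0]; tm 1 [:: 1; 0; 1; 0; 0; 3; 0; 0];
       tm (-1) [:: 1; 0; 1; 0; 0; 1; 0; 2]; tm 1 [:: 0; 0; 0; 2; 0; 2; 0; 0];
       tm 1 [:: 1; 0; 0; 1; 0; 1; 1; 1]];
     minor 3 7 [:: tm (-1) [:: 1; 0; 1; 2; 0; 0; 0; 1];
       tm 1 [:: 0; 0; 1; 1; 0; 1; 1; 0]; tm 1 [:: 1; 0; 0; 3; 0; 0; 1; 0];
       tm 1 [:: 0; 0; 0; 1; 1; 0; 1; 1]];
     minor 3 8 [:: tm 1 [:: 0; 0; 2; 1; 0; 0; 0; 1];
       tm 1 [:: 1; 0; 2; 0; 0; 1; 1; 0]; tm (-1) [:: 0; 0; 1; 2; 0; 0; 1; 0];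
       tm 1 [:: 1; 0; 1; 0; 1; 0; 1; 1]];
     minor 3 9 [:: tm (-1) [:: 0; 0; 2; 1; 1; 0; 0; 0];
       tm 1 [:: 1; 1; 2; 0; 0; 0; 1; 1]; tm (-1) [:: 0; 0; 1; 1; 0; 1; 0; 1];
       tm (-1) [:: 1; 1; 1; 1; 0; 0; 2; 0]; tm 2 [:: 0; 0; 0; 2; 0; 1; 1; 0]];
     minor 4 5 [:: tm (-1) [:: 0; 0; 2; 1; 0; 0; 1; 0];
       tm 1 [:: 1; 0; 1; 2; 1; 0; 0; 0]; tm 1 [:: 0; 1; 1; 1; 0; 0; 1; 1];
       tm (-1) [:: 1; 1; 1; 0; 0; 1; 2; 0]; tm (-1) [:: 0; 1; 0; 2; 0; 0; 2; 0];
       tm (-1) [:: 0; 0; 0; 1; 0; 0; 1; 2]];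
     minor 4 6 [:: tm (-1) [:: 0; 0; 2; 1; 0; 0; 0; 1];
       tm 1 [:: 1; 0; 2; 0; 0; 1; 1; 0]; tm 1 [:: 0; 0; 1; 2; 0; 0; 1; 0];
       tm 1 [:: 1; 0; 1; 0; 1; 0; 1; 1]];
     minor 4 7 [:: tm 1 [:: 1; 0; 1; 1; 2; 0; 0; 0];
       tm 1 [:: 0; 1; 1; 0; 1; 0; 1; 1]; tm (-1) [:: 0; 0; 1; 0; 0; 1; 1; 1];
       tm (-1) [:: 0; 1; 0; 1; 1; 0; 2; 0];
       tm (-1) [:: 0; 0; 0; 0; 1; 0; 1; 2]];
     minor 4 8 [:: tm 1 [:: 0; 0; 1; 1; 0; 0; 1; 1];
       tm (-1) [:: 1; 0; 1; 0; 0; 1; 2; 0]; tm (-1) [:: 0; 0; 0; 2; 0; 0; 2; 0];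
       tm (-1) [:: 1; 0; 0; 0; 1; 0; 2; 1]];
     minor 4 9 [:: tm 1 [:: 0; 0; 1; 1; 1; 0; 1; 0];
       tm (-1) [:: 1; 1; 1; 0; 0; 0; 2; 1]; tm (-1) [:: 0; 0; 0; 1; 0; 1; 1; 1];
       tm 1 [:: 1; 1; 0; 1; 0; 0; 3; 0]];
     minor 5 6 [:: tm 1 [:: 0; 0; 1; 1; 1; 0; 0; 1];
       tm (-1) [:: 0; 1; 1; 1; 0; 1; 0; 1]; tm 1 [:: 1; 1; 1; 0; 0; 2; 1; 0];
       tm 1 [:: 0; 1; 0; 2; 0; 1; 1; 0]; tm 1 [:: 0; 0; 0; 1; 0; 1; 0; 2]];
     minor 5 7 [:: tm (-1) [:: 1; 0; 2; 1; 1; 0; 0; 0];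
       tm (-1) [:: 0; 1; 2; 0; 0; 0; 1; 1]; tm (-1) [:: 1; 0; 1; 1; 0; 1; 0; 1];
       tm 1 [:: 0; 1; 1; 1; 0; 0; 2; 0]];
     minor 5 8 [:: tm 1 [:: 1; 0; 1; 2; 0; 0; 0; 1];
       tm 1 [:: 0; 0; 1; 1; 0; 1; 1; 0]; tm (-1) [:: 1; 0; 0; 3; 0; 0; 1; 0];
       tm (-1) [:: 0; 0; 0; 1; 1; 0; 1; 1]];
     minor 5 9 [:: tm (-1) [:: 1; 0; 1; 2; 1; 0; 0; 0];
       tm (-1) [:: 0; 1; 1; 1; 0; 0; 1; 1]; tm (-1) [:: 1; 0; 0; 2; 0; 1; 0; 1];
       tm 1 [:: 0; 1; 0; 2; 0; 0; 2; 0]];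
     minor 6 7 [:: tm 1 [:: 0; 0; 3; 0; 0; 0; 0; 1];
       tm (-1) [:: 0; 0; 2; 1; 0; 0; 1; 0]; tm (-1) [:: 0; 1; 2; 0; 0; 0; 0; 2];
       tm 2 [:: 0; 1; 1; 1; 0; 0; 1; 1]; tm (-1) [:: 0; 0; 1; 0; 2; 0; 0; 1];
       tm (-1) [:: 0; 0; 1; 0; 0; 2; 0; 1]; tm 1 [:: 0; 0; 1; 0; 0; 0; 0; 3];
       tm (-1) [:: 0; 1; 0; 2; 0; 0; 2; 0];
       tm (-1) [:: 0; 0; 0; 1; 0; 0; 1; 2]];
     minor 6 8 [:: tm 1 [:: 0; 0; 1; 1; 0; 1; 0; 1];
       tm (-1) [:: 1; 0; 1; 0; 0; 2; 1; 0]; tm 1 [:: 1; 0; 1; 0; 0; 0; 1; 2];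
       tm (-1) [:: 0; 0; 0; 2; 0; 1; 1; 0];
       tm (-1) [:: 1; 0; 0; 1; 0; 0; 2; 1]];
     minor 6 9 [:: tm 1 [:: 0; 0; 2; 1; 0; 0; 0; 1];
       tm (-1) [:: 0; 0; 1; 2; 0; 0; 1; 0]; tm (-1) [:: 1; 1; 1; 0; 0; 1; 1; 1];
       tm (-1) [:: 0; 0; 0; 1; 0; 2; 0; 1]; tm 1 [:: 1; 1; 0; 1; 0; 1; 2; 0]];
     minor 7 8 [:: tm 1 [:: 0; 0; 2; 0; 0; 0; 1; 1];
       tm 1 [:: 1; 0; 1; 1; 1; 0; 0; 1]; tm (-1) [:: 0; 0; 1; 1; 0; 0; 2; 0];
       tm (-1) [:: 1; 0; 0; 2; 1; 0; 1; 0];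
       tm (-1) [:: 0; 0; 0; 0; 2; 0; 1; 1]];
     minor 7 9 [:: tm (-1) [:: 1; 0; 1; 1; 2; 0; 0; 0];
       tm 1 [:: 1; 0; 1; 1; 0; 0; 0; 2]; tm (-1) [:: 0; 1; 1; 0; 1; 0; 1; 1];
       tm (-1) [:: 1; 0; 0; 2; 0; 0; 1; 1]; tm 1 [:: 0; 1; 0; 1; 1; 0; 2; 0]];
     minor 8 9 [:: tm (-2) [:: 0; 0; 1; 1; 0; 0; 1; 1];
       tm 2 [:: 0; 0; 0; 2; 0; 0; 2; 0]]].

Definition svar (n k : nat) : spoly :=
  [:: (1, [seq (j == k : nat) | j <- iota 0 n])].

Definition s_uv (k : nat) : spoly := svar 10 (k + 2).
Definition s_i : spoly := svar 10 0.
Definition s_g : spoly := svar 10 1.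

Definition s_line_mx : seq (seq spoly) :=
  let u k := s_uv k.-1 in let v k := s_uv (k + 3) in
  let o : spoly := [::] in
  [:: [::          o;        u 1;            o;                o;          o;        v 1;            o;                o];
      [::        u 2;          o;            o;                o;        v 2;          o;            o;                o];
      [::          o;          o;            o;              u 3;          o;          o;            o;              v 3];
      [::          o;          o;          u 4;                o;          o;          o;          v 4;                o];
      [::        u 3;          o;          u 1;                o;        v 3;          o;          v 1;                o];
      [::          o;        u 4;            o;              u 2;          o;        v 4;            o;              v 2];
      [:: sopp (u 4);          o;            o; smul s_i (u 1); sopp (v 4);          o;            o; smul s_i (v 1)];
      [::          o; sopp (u 3); smul s_i (u 2);              o;          o; sopp (v 3); smul s_i (v 2);              o];
      [::        u 1;          o;          u 3; smul s_g (u 2);        v 1;          o;          v 3; smul s_g (v 2)];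
      [::          o;        u 2;          u 1;              u 4;          o;        v 2;          v 1;              v 4]]%N.

Definition s_N : seq spoly :=
  let N j k := smul (s_uv j) (s_uv (k + 4)) ++ sopp (smul (s_uv k) (s_uv (j + 4))) in
  [:: s_i; s_g; N 0 1; N 0 2; N 0 3; N 1 2; N 1 3; N 2 3]%N.

Definition s_M : seq spoly :=
  let M k := svar 8 (k + 2) in
  [:: svar 8 0; svar 8 1; M 5; sopp (M 4); M 3; M 2; sopp (M 1); M 0]%N.

Definition s_plucker : spoly :=
  let M k := svar 8 (k + 2) in
  (smul (M 0) (M 5) ++ sopp (smul (M 1) (M 4)) ++ smul (M 2) (M 3))%N.

Definition minor_rows (d : nat * nat * spoly) : seq nat :=
  [seq k <- iota 0 10 | (k != d.1.1) && (k != d.1.2)].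

Definition minor_ok (d : nat * nat * spoly) : bool :=
  [&& size (minor_rows d) == 8%N,
      all (fun t => (size t.2 == 8%N) && (sumn (drop 2 t.2) == 4%N)) d.2 &
      scollect (sreduce (sdet 8 [seq nth [::] s_line_mx k | k <- minor_rows d] ++
                         sopp (ssubst s_N d.2))) == [::]].

Lemma minor_data_ok : all minor_ok minor_data.
Proof. by vm_compute. Qed.

Lemma seval_line_mx_entries (A : comNzRingType)
    (x y u1 u2 u3 u4 v1 v2 v3 v4 : A) :
  [seq [seq seval [:: x; y; u1; u2; u3; u4; v1; v2; v3; v4] p | p <- l]
  | l <- s_line_mx] =
   [:: [::    0;    u1;       0;           0;    0;    v1;       0;           0];
       [::   u2;     0;       0;           0;   v2;     0;       0;           0];
       [::    0;     0;       0;          u3;    0;     0;       0;          v3];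
       [::    0;     0;      u4;           0;    0;     0;      v4;           0];
       [::   u3;     0;      u1;           0;   v3;     0;      v1;           0];
       [::    0;    u4;       0;          u2;    0;    v4;       0;          v2];
       [:: - u4;     0;       0;      x * u1; - v4;     0;       0;      x * v1];
       [::    0;  - u3;  x * u2;           0;    0;  - v3;  x * v2;           0];
       [::   u1;     0;      u3;      y * u2;   v1;     0;      v3;      y * v2];
       [::    0;    u2;      u1;          u4;    0;    v2;      v1;          v4]].
Proof.
rewrite /s_line_mx /= !seval_nil !seval_cons !seval_nil /=.
by rewrite !expr0 !expr1 ?rmorphN1 ?mulr1z ?mul1r ?mulr1 ?addr0 ?mulN1r.
Qed.

Lemma seval_N (A : comNzRingType) (x y u1 u2 u3 u4 v1 v2 v3 v4 : A) :
  map (seval [:: x; y; u1; u2; u3; u4; v1; v2; v3; v4]) s_N =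
  [:: x; y; u1 * v2 - u2 * v1; u1 * v3 - u3 * v1; u1 * v4 - u4 * v1;
            u2 * v3 - u3 * v2; u2 * v4 - u4 * v2; u3 * v4 - u4 * v3].
Proof.
rewrite /s_N /= !seval_cons !seval_nil /=.
by rewrite !expr0 !expr1 ?rmorphN1 ?mulr1z ?mul1r ?mulr1 ?addr0 ?mulN1r.
Qed.

Lemma seval_M (A : comNzRingType) (x y a b c d e f : A) :
  map (seval [:: x; y; a; b; c; d; e; f]) s_M = [:: x; y; f; - e; d; c; - b; a].
Proof.
rewrite /s_M /= !seval_cons !seval_nil /=.
by rewrite !expr0 !expr1 ?rmorphN1 ?mulr1z ?mul1r ?mulr1 ?addr0 ?mulN1r.
Qed.

Lemma seval_plucker (A : comNzRingType) (x y a b c d e f : A) :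
  seval [:: x; y; a; b; c; d; e; f] s_plucker = a * f - b * e + c * d.
Proof.
rewrite /s_plucker !seval_cons !seval_nil /=.
rewrite !expr0 !expr1 ?rmorphN1 ?mulr1z ?mul1r ?mulr1 ?addr0 ?mulN1r addrA.
by [].
Qed.

Lemma row_ord (n : nat) (A : seq (seq spoly)) (l : seq nat) (k : 'I_n) :
  size l = n -> nth [::] [seq nth [::] A j | j <- l] k = nth [::] A (nth 0%N l k).
Proof. by move=> szl; rewrite (nth_map 0%N) // szl. Qed.

Section Membership.
Variables (K : fieldType) (i gamma : K).
Hypothesis i2 : i ^+ 2 = -1.

Definition uv_env : seq {mpoly K[8]} :=
  [:: i%:MP; gamma%:MP; u1 K; u2 K; u3 K; u4 K; v1 K; v2 K; v3 K; v4 K].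

Definition M_env : seq {mpoly K[6]} :=
  [:: i%:MP; gamma%:MP; M12 K; M13 K; M14 K; M23 K; M24 K; M34 K].

Lemma mpolyC_i2 n : (i%:MP : {mpoly K[n]}) ^+ 2 = -1.
Proof. by rewrite -rmorphXn i2 rmorphN1. Qed.

Lemma seval_line_mx (r : 'I_10) (c : 'I_8) :
  seval uv_env (nth [::] (nth [::] s_line_mx r) c) = line_mx i gamma r c.
Proof.
rewrite mxE -!mul_mpolyC -seval_line_mx_entries.
rewrite (nth_map [::]) ?ltn_ord //; case: (ltnP c (size (nth [::] s_line_mx r))).
  by move=> ltc; rewrite (nth_map [::]).
move=> lec; rewrite [nth _ (nth _ _ _) _]nth_default // seval_nil.
by rewrite nth_default ?size_map.
Qed.

Lemma mon_eval_homog n (l : seq {mpoly K[n]}) e :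
  {in l, forall p : {mpoly K[n]}, p \is 1.-homog} -> size e = size l ->
  mon_eval l e \is (sumn e).-homog.
Proof.
elim: l e => [|p l IH] [|k e] //= hl; first by rewrite dhomog1.
move=> [sze]; rewrite -[k in (k + _)%N]mul1n; apply: dhomogM.
  by apply/dhomogMn/hl; rewrite mem_head.
by apply: IH => // q lq; apply: hl; rewrite inE lq orbT.
Qed.

Lemma minor_generator d : minor_ok d ->
  line_scheme_generator i gamma (seval M_env (ssubst s_M d.2)).
Proof.
case/and3P=> /eqP szl homQ /eqP detQ; right.
have lt10 k : (k < 8)%N -> (nth 0 (minor_rows d) k < 10)%N.
    move=> ltk; have : nth 0%N (minor_rows d) k \in minor_rows d.
      by rewrite mem_nth // szl.
    by rewrite mem_filter mem_iota => /andP[].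
exists (fun k => inord (nth 0%N (minor_rows d) k)), (seval M_env d.2); split.
- move=> a b ltab; rewrite !inordK ?lt10 //.
  apply: (sorted_ltn_nth ltn_trans) => //; rewrite ?inE ?szl //.
  by apply: sorted_filter ltn_trans _ _ _; apply: iota_ltn_sorted.
- have X1 (j : 'I_6) : ('X_j : {mpoly K[6]}) \is 1.-homog.
    by rewrite dhomogX; apply/eqP; exact: mdeg1.
  rewrite /seval big_seq; apply: rpred_sum => t dt.
  case: t {dt} (allP homQ t dt) => c e /=.
  case: e => [|j [|k e]] // /andP[/eqP[sze]]; rewrite /= drop0 => /eqP sume.
  rewrite -(rmorph_int (@mpolyC 6 K)) mul_mpolyC rpredZ //=.
  rewrite -!rmorphXn !mul_mpolyC !rpredZ //=.
  have := @mon_eval_homog _ [:: M12 K; M13 K; M14 K; M23 K; M24 K; M34 K] e.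
  rewrite sume; apply=> //.
  by apply/allP; rewrite /= !X1.
- rewrite [LHS](rmorph_seval (comp_mpoly (N_uv K))) /=.
  rewrite !comp_mpolyC !comp_mpolyXU /=.
  rewrite -seval_N -seval_subst -/uv_env; apply/esym/eqP.
  (* The check compares the determinant with the substituted quartic only after reduction by i^2 =
     -1, the first entry of [uv_env] being i. *)
  have := seval_reduce (drop 1 uv_env)
    (sdet 8 [seq nth [::] s_line_mx k | k <- minor_rows d] ++
     sopp (ssubst s_N d.2)) (mpolyC_i2 8).
  rewrite -seval_collect detQ seval_nil seval_cat seval_opp -/uv_env.
  move/esym/eqP; rewrite subr_eq0 seval_det => /eqP <-.
  apply/eqP; congr (\det _); apply/matrixP => r c; rewrite mxE [RHS]mxE.
  by rewrite -seval_line_mx row_ord // inordK ?lt10.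
- rewrite [RHS](rmorph_seval (comp_mpoly (N_to_M K))) /=.
  rewrite !comp_mpolyC !comp_mpolyXU /=.
  by rewrite seval_subst seval_M.
Qed.

End Membership.

(** * Normal forms modulo the ideal *)

(* [rule L cert q]: the sum of c * F_k over the terms (c, k) of cert, where F_k
   comes from the k-th minor, plus q times the Plucker polynomial, is a multiple
   of L by a unit plus monomials of smaller weight.  Found by Gaussian elimination
   on the degree 4 part of the ideal over Q(i, gamma).  The exponents in L are
   those of M12, .., M34; those in c of i, gamma; those in q of all of them. *)
Definition rule_data : seq (seq nat * seq (int * seq nat * nat) * spoly) :=
  [:: rule [:: 0; 1; 0; 1; 2; 0] [:: term (-1) [:: 0; 0] 16;
    term (-1) [:: 0; 0] 35; term (-1) [:: 0; 1] 40] [::];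
     rule [:: 0; 1; 1; 0; 2; 0] [:: term (-1) [:: 0; 0] 29;
       term (-1) [:: 1; 0] 36] [::];
     rule [:: 0; 0; 1; 1; 2; 0] [:: term 1 [:: 0; 0] 13; term (-1) [:: 1; 0] 27]
       [:: tm 2 [:: 0; 0; 0; 0; 0; 0; 2; 0]];
     rule [:: 0; 0; 0; 1; 2; 1] [:: term 1 [:: 0; 0] 10; term 1 [:: 1; 0] 38;
       term (-1) [:: 1; 0] 39; term (-1) [:: 1; 1] 44] [::];
     rule [:: 1; 0; 1; 0; 2; 0] [:: term (-1) [:: 0; 0] 10; term 1 [:: 1; 0] 38;
       term 1 [:: 1; 0] 39] [::];
     rule [:: 0; 2; 0; 1; 1; 0] [:: term 1 [:: 0; 0] 22; term 1 [:: 1; 0] 31]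
       [::];
     rule [:: 0; 2; 1; 0; 1; 0] [:: term 1 [:: 0; 0] 7; term 1 [:: 0; 0] 32;
       term 1 [:: 0; 0] 43] [::];
     rule [:: 0; 1; 0; 2; 1; 0] [:: term 1 [:: 0; 0] 9; term (-1) [:: 0; 0] 30;
       term 1 [:: 0; 1] 33] [::];
     rule [:: 0; 1; 1; 1; 1; 0] [:: term 1 [:: 0; 0] 44] [::
       tm 2 [:: 0; 0; 0; 1; 0; 0; 1; 0]];
     rule [:: 0; 1; 0; 1; 1; 1] [:: term 1 [:: 0; 0] 20; term 1 [:: 0; 0] 34]
       [::];
     rule [:: 1; 1; 0; 1; 1; 0] [:: term (-1) [:: 1; 0] 13;
       term (-1) [:: 0; 0] 37] [::];
     rule [:: 0; 1; 2; 0; 1; 0] [:: term (-1) [:: 0; 0] 2;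
       term (-1) [:: 0; 0] 30; term (-1) [:: 0; 0] 38] [::];
     rule [:: 0; 1; 1; 0; 1; 1] [:: term 1 [:: 0; 0] 27; term 1 [:: 0; 0] 37]
       [::];
     rule [:: 1; 1; 1; 0; 1; 0] [:: term (-1) [:: 1; 0] 6;
       term (-1) [:: 0; 0] 34] [::];
     rule [:: 2; 1; 0; 0; 1; 0] [:: term (-1) [:: 1; 0] 1; term 1 [:: 1; 0] 10;
       term (-2) [:: 0; 0] 30; term 1 [:: 0; 1] 33; term (-1) [:: 0; 0] 38;
       term 2 [:: 0; 0] 39; term 1 [:: 0; 1] 44] [::];
     rule [:: 0; 0; 1; 2; 1; 0] [:: term (-1) [:: 0; 0] 11;
       term (-1) [:: 1; 0] 42] [:: tm 2 [:: 0; 0; 0; 0; 0; 1; 1; 0]];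
     rule [:: 0; 0; 0; 2; 1; 1] [:: term (-1) [:: 0; 0] 15; term 1 [:: 1; 0] 19;
       term (-1) [:: 1; 1] 22; term 1 [:: 1; 0] 32] [::];
     rule [:: 0; 0; 2; 1; 1; 0] [:: term 1 [:: 0; 0] 24; term (-1) [:: 0; 0] 29;
       term 1 [:: 0; 0] 40] [:: tm 2 [:: 0; 0; 0; 0; 1; 0; 1; 0]];
     rule [:: 0; 0; 1; 1; 1; 1] [:: term 1 [:: 0; 0] 28; term (-1) [:: 0; 0] 31]
       [:: tm 2 [:: 0; 0; 0; 0; 0; 0; 1; 1]];
     rule [:: 1; 0; 1; 1; 1; 0] [:: term 1 [:: 0; 0] 15; term (-1) [:: 1; 0] 32;
       term (-1) [:: 1; 0] 43] [:: tm 2 [:: 0; 0; 1; 0; 0; 0; 1; 0]];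
     rule [:: 0; 0; 0; 1; 1; 2] [:: term (-1) [:: 1; 0] 23; term 1 [:: 0; 0] 24;
       term 1 [:: 0; 0] 40] [::];
     rule [:: 1; 0; 2; 0; 1; 0] [:: term 1 [:: 1; 0] 4; term (-1) [:: 0; 0] 28;
       term 1 [:: 0; 0] 31; term 1 [:: 0; 0] 41] [::];
     rule [:: 2; 0; 1; 0; 1; 0] [:: term 1 [:: 1; 0] 8; term (-1) [:: 0; 0] 11;
       term 1 [:: 0; 0] 16; term (-1) [:: 1; 0] 42] [::];
     rule [:: 0; 0; 0; 0; 1; 3] [:: term 1 [:: 1; 0] 19; term (-2) [:: 0; 0] 25;
       term 1 [:: 0; 1] 28; term 1 [:: 1; 0] 43] [::];
     rule [:: 3; 0; 0; 0; 1; 0] [:: term 1 [:: 1; 0] 4; term (-1) [:: 1; 1] 7;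
       term 2 [:: 0; 0] 12; term (-1) [:: 0; 1] 15; term (-1) [:: 0; 0] 41]
       [::];
     rule [:: 0; 2; 1; 1; 0; 0] [:: term (-1) [:: 0; 0] 6; term 1 [:: 1; 0] 20]
       [:: tm 2 [:: 0; 1; 0; 2; 0; 0; 0; 0]];
     rule [:: 1; 2; 0; 1; 0; 0] [:: term (-1) [:: 0; 0] 1; term 1 [:: 1; 1] 33;
       term (-1) [:: 1; 0] 39] [::];
     rule [:: 0; 2; 1; 0; 0; 1] [:: term 1 [:: 0; 0] 1; term 1 [:: 1; 1] 33;
       term 1 [:: 1; 0] 39; term 1 [:: 1; 1] 44] [::];
     rule [:: 0; 1; 1; 2; 0; 0] [:: term (-1) [:: 0; 0] 19; term 1 [:: 0; 1] 22;
       term (-1) [:: 0; 0] 43] [:: tm 2 [:: 0; 1; 0; 1; 0; 1; 0; 0]];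
     rule [:: 1; 1; 0; 2; 0; 0] [:: term 1 [:: 1; 1] 11; term (-1) [:: 0; 0] 23;
       term 1 [:: 0; 0] 36; term 1 [:: 0; 1] 42] [::];
     rule [:: 0; 1; 2; 1; 0; 0] [:: term 1 [:: 0; 0] 4; term 1 [:: 1; 0] 41] [::
       tm 2 [:: 0; 1; 0; 1; 1; 0; 0; 0]];
     rule [:: 0; 1; 1; 1; 0; 1] [:: term 1 [:: 0; 0] 23; term (-1) [:: 0; 0] 36]
       [:: tm 2 [:: 0; 1; 0; 1; 0; 0; 0; 1]];
     rule [:: 1; 1; 1; 1; 0; 0] [:: term 1 [:: 0; 0] 8; term (-1) [:: 1; 0] 35;
       term (-1) [:: 1; 1] 40] [:: tm 2 [:: 0; 1; 1; 1; 0; 0; 0; 0]];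
     rule [:: 2; 1; 0; 1; 0; 0] [:: term 1 [:: 0; 0] 4; term (-1) [:: 0; 1] 7;
       term (-1) [:: 1; 1] 15; term 1 [:: 1; 0] 41] [::];
     rule [:: 0; 1; 2; 0; 0; 1] [:: term (-1) [:: 0; 0] 8; term 1 [:: 1; 1] 24;
       term (-1) [:: 1; 1] 29; term 1 [:: 1; 0] 35] [::];
     rule [:: 0; 1; 1; 0; 0; 2] [:: term (-1) [:: 0; 0] 19; term 1 [:: 1; 1] 28;
       term (-1) [:: 0; 0] 43] [::];
     rule [:: 0; 1; 0; 0; 0; 3] [:: term (-2) [:: 0; 0] 18; term 1 [:: 0; 0] 23;
       term 1 [:: 1; 0] 24; term 1 [:: 1; 0] 40] [::];
     rule [:: 3; 1; 0; 0; 0; 0] [:: term 2 [:: 0; 0] 3; term (-1) [:: 0; 0] 8;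
       term 1 [:: 1; 0] 11; term (-1) [:: 1; 0] 16; term (-1) [:: 0; 0] 42]
       [::];
     rule [:: 2; 0; 1; 1; 0; 0] [:: term 1 [:: 0; 0] 2; term (-1) [:: 0; 0] 9;
       term 2 [:: 0; 0] 30; term (-1) [:: 0; 1] 33; term 1 [:: 0; 0] 38;
       term (-2) [:: 0; 0] 39] [:: tm 2 [:: 0; 0; 2; 0; 0; 0; 0; 0];
       tm (-2) [:: 0; 1; 1; 0; 0; 0; 0; 1]; tm 2 [:: 0; 1; 0; 1; 0; 0; 1; 0];
       tm (-2) [:: 0; 0; 0; 0; 2; 0; 0; 0]; tm 2 [:: 0; 1; 0; 0; 1; 1; 0; 0];
       tm (-2) [:: 0; 0; 0; 0; 0; 2; 0; 0]; tm 2 [:: 0; 0; 0; 0; 0; 0; 0; 2]];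
     rule [:: 0; 0; 0; 1; 0; 3] [:: term 2 [:: 1; 0] 21; term (-1) [:: 0; 0] 27;
       term (-1) [:: 0; 0] 37] [:: tm (-2) [:: 0; 0; 1; 0; 0; 1; 0; 0];
       tm (-2) [:: 0; 0; 0; 0; 1; 0; 0; 1]; tm 2 [:: 0; 1; 0; 0; 0; 1; 0; 1]];
     rule [:: 3; 0; 0; 1; 0; 0] [:: term 1 [:: 1; 0] 6; term (-2) [:: 0; 0] 14;
       term 1 [:: 0; 0] 34] [:: tm (-2) [:: 0; 0; 1; 0; 1; 0; 0; 0];
       tm 2 [:: 0; 1; 1; 0; 0; 1; 0; 0]; tm (-2) [:: 0; 0; 0; 0; 0; 1; 0; 1]];
     rule [:: 0; 0; 1; 0; 0; 3] [:: term (-1) [:: 0; 0] 20; term 2 [:: 1; 0] 26;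
       term (-1) [:: 0; 0] 34] [:: tm (-2) [:: 0; 0; 1; 0; 1; 0; 0; 0];
       tm 2 [:: 0; 1; 0; 0; 1; 0; 0; 1]; tm (-2) [:: 0; 0; 0; 0; 0; 1; 0; 1]];
     rule [:: 3; 0; 1; 0; 0; 0] [:: term (-2) [:: 0; 0] 5; term 1 [:: 1; 0] 13;
       term 1 [:: 0; 0] 37] [:: tm 2 [:: 0; 1; 1; 0; 1; 0; 0; 0];
       tm (-2) [:: 0; 0; 1; 0; 0; 1; 0; 0];
       tm (-2) [:: 0; 0; 0; 0; 1; 0; 0; 1]];
     rule [:: 0; 0; 0; 0; 0; 4] [:: term (-2) [:: 0; 0] 17] [::
       tm (-2) [:: 0; 0; 1; 0; 0; 0; 0; 1]; tm 2 [:: 0; 0; 0; 1; 0; 0; 1; 0];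
       tm 2 [:: 0; 0; 0; 0; 1; 1; 0; 0]; tm 2 [:: 0; 1; 0; 0; 0; 0; 0; 2]];
     rule [:: 4; 0; 0; 0; 0; 0] [:: term (-1) [:: 0; 0] 0] [::];
     rule [:: 1; 0; 0; 0; 0; 1] [::] [:: tm 1 [:: 0; 0; 0; 0; 0; 0; 0; 0]]].

Definition rule_poly (r : seq nat * seq (int * seq nat * nat) * spoly) : spoly :=
  scollect (sreduce
    (flatten [seq smul [:: s.1] (ssubst s_M (nth (minor 0 0 [::]) minor_data s.2).2)
             | s <- r.1.2] ++ smul r.2 s_plucker)).

(** Since a outweighs f, the monomials a^2cd and a^2be lead over f^2cd and f^2be. This is why w =
    f^2, but not w = a^2, is combined with {c, d} and {b, e}. *)
Definition weight (e : seq nat) : nat := (3 * nth 0 e 0 + 2 * nth 0 e 5)%N.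

(** The last condition says that L occurs once, with a coefficient (n + 1) gamma^k free of i. Such a
    coefficient is nonzero in characteristic 0 for every nonzero gamma, so one table serves all
    gamma. *)
Definition rule_ok (r : seq nat * seq (int * seq nat * nat) * spoly) : bool :=
  let L := r.1.1 in
  [&& size L == 6%N,
      all (fun s => (s.2 < size minor_data)%N) r.1.2,
      all (fun t => [&& size t.2 == 8%N, sumn (drop 2 t.2) == sumn L &
                        (drop 2 t.2 == L) || (weight (drop 2 t.2) < weight L)%N])
          (rule_poly r) &
      if [seq t <- rule_poly r | drop 2 t.2 == L] is [:: (Posz n.+1, 0%N :: _)]
      then true else false].

Lemma rule_data_ok : all rule_ok rule_data.
Proof. by vm_compute. Qed.

(* ((k, l), (y, z)) stands for the monomials a^k f^l y^s z^t, where y and z are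
   given by their positions in M12, .., M34. *)
Definition std_edges : seq (nat * nat * (nat * nat)) :=
  [:: (0, 0, (2, 3)); (0, 0, (1, 4)); (0, 0, (3, 4)); (0, 0, (2, 1));
      (0, 0, (2, 4)); (0, 0, (3, 1));
      (1, 0, (2, 3)); (1, 0, (1, 4)); (1, 0, (3, 4)); (1, 0, (2, 1));
      (2, 0, (3, 4)); (2, 0, (2, 1));
      (0, 1, (2, 3)); (0, 1, (1, 4)); (0, 1, (2, 4)); (0, 1, (3, 1));
      (0, 2, (2, 3)); (0, 2, (1, 4)); (0, 2, (2, 4)); (0, 2, (3, 1))]%N.

Definition std_at (s : nat * nat * (nat * nat)) (e : seq nat) : bool :=
  [&& nth 0%N e 0 == s.1.1, nth 0%N e 5 == s.1.2 &
      all (fun k => [|| k == s.2.1, k == s.2.2 | nth 0%N e k == 0%N])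
          [:: 1; 2; 3; 4]%N].

Definition std (e : seq nat) : bool := has (std_at^~ e) std_edges.

Fixpoint expo_below (n k : nat) : seq (seq nat) :=
  if n is n'.+1 then [seq a :: l | a <- iota 0 k, l <- expo_below n' k]
  else [:: [::]].

Definition dvd_expo (L e : seq nat) := all (fun k => nth 0 L k <= nth 0 e k)%N (iota 0 6).

Lemma std_or_reducible_below :
  all (fun e => [|| (sumn e < 4)%N, std e |
                    has (fun r => dvd_expo r.1.1 e) rule_data]) (expo_below 6 5).
Proof. by vm_compute. Qed.

Lemma mem_expo_below n k e :
  (e \in expo_below n k) = (size e == n) && all (fun a => a < k)%N e.
Proof.
elim: n e => [|n IH] [|a e] //=; first by apply/allpairsP => -[[b l] []].
apply/allpairsP/idP => [[[b l] /= [bk lk [-> ->]]]|].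
  move: lk bk; rewrite IH mem_iota eqSS => /andP[-> ->] /andP[_ ->] //.
case/and3P=> sze ak alle; exists (a, e); rewrite /= IH mem_iota add0n ak alle andbT.
by split=> //; rewrite andbT.
Qed.

(** Truncating the exponents at 4 reduces this to the finite check. What divides the truncation
    divides e; [std] only compares exponents with numbers below 4; and a single exponent that is at
    least 4 keeps the degree of the truncation at least 4. *)
Lemma std_or_reducible e : size e = 6%N -> (4 <= sumn e)%N ->
  std e \/ exists2 r, r \in rule_data & dvd_expo r.1.1 e.
Proof.
move=> sze dege; pose e' := [seq minn a 4 | a <- e].
have ne' k : nth 0%N e' k = minn (nth 0%N e k) 4.
  case: (ltnP k (size e)) => [ltk|lek]; first exact: nth_map.
  by rewrite !nth_default ?size_map.
have : e' \in expo_below 6 5.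
  rewrite mem_expo_below size_map sze eqxx; apply/allP => _ /mapP[a _ ->].
  by rewrite ltnS geq_minr.
move=> /(allP std_or_reducible_below) /or3P[|std_e'|/hasP[r r_in dvdr]].
- have [le4|/hasPn gt4] := boolP (has (fun a => 4 <= a)%N e).
    have /hasP[a ae le4a] := le4; rewrite ltnNge => /negP[].
    have : minn a 4 \in e' by apply: map_f.
    rewrite (minn_idPr le4a); elim: (e') => // b l IHl; rewrite inE /=.
    case/predU1P => [<-|/IHl]; first exact: leq_addr.
    by move=> le; apply: leq_trans le (leq_addl _ _).
  have -> : e' = e; last by rewrite ltnNge dege.
  apply: map_id_in => a ae; apply/minn_idPl.
  by rewrite leqNgt; apply: contra (gt4 a ae) => /ltnW.
- left; case/hasP: std_e' => s s_in std_s; apply/hasP; exists s => //.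
  move: std_s; rewrite /std_at !ne'.
  have e3 : (s.1.1 < 4)%N && (s.1.2 < 4)%N.
    by apply: (@allP _ (fun s => (s.1.1 < 4)%N && (s.1.2 < 4)%N) std_edges isT s s_in).
  case/andP: e3 => lt1 lt2.
  have minE a b : (b < 4)%N -> minn a 4 == b -> a == b.
    by move=> b4; rewrite /minn; case: ifP => // _ /eqP E; rewrite -E in b4.
  case/and3P=> /(minE _ _ lt1) -> /(minE _ _ lt2) -> /= /and5P[h1 h2 h3 h4 _].
  by apply/and5P; split=> //; [move: h1 | move: h2 | move: h3 | move: h4];
     rewrite ne' => /or3P[->|->|/minE ->] //; rewrite ?orbT.
- right; exists r => //; move: dvdr; apply: sub_all => k; rewrite ne' => le.
  exact: leq_trans le (geq_minl _ _).
Qed.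

Section IdealGen.
Variables (A : comNzRingType) (G : A -> Prop).
Local Notation I := (ideal_gen G).

Lemma ideal_gen0 : I 0.
Proof. by exists [::]; rewrite big_nil. Qed.

Lemma ideal_genD f g : I f -> I g -> I (f + g).
Proof.
move=> [s [sG ->]] [t [tG ->]]; exists (s ++ t); split; last by rewrite big_cat.
by move=> c; rewrite mem_cat => /orP[/sG|/tG].
Qed.

Lemma ideal_genMl a f : I f -> I (a * f).
Proof.
move=> [s [sG ->]]; exists [seq (a * c.1, c.2) | c <- s]; split.
  by move=> _ /mapP[c /sG Gc ->].
by rewrite big_map mulr_sumr; apply: eq_bigr => c _; rewrite mulrA.
Qed.

Lemma ideal_gen_gen f : G f -> I f.
Proof.
exists [:: (1, f)]; rewrite big_seq1 mul1r; split=> // c.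
by rewrite inE => /eqP ->.
Qed.

Lemma ideal_gen_sum (T : eqType) (r : seq T) (F : T -> A) :
  {in r, forall x, I (F x)} -> I (\sum_(x <- r) F x).
Proof.
move=> IF; rewrite big_seq; elim/big_ind: _ => //; first exact: ideal_gen0.
exact: ideal_genD.
Qed.

End IdealGen.

Definition mnm_of (e : seq nat) : 'X_{1..6} := [multinom nth 0%N e j | j < 6].

Definition expo_of (x : 'X_{1..6}) : seq nat := [seq x j | j <- enum 'I_6].

Lemma size_expo_of x : size (expo_of x) = 6%N.
Proof. by rewrite size_map size_enum_ord. Qed.

Lemma nth_expo_of x (j : 'I_6) : nth 0%N (expo_of x) j = x j.
Proof. by rewrite (nth_map ord0) ?size_enum_ord // nth_ord_enum. Qed.

Lemma expo_ofK : cancel expo_of mnm_of.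
Proof. by move=> x; apply/mnmP => j; rewrite mnmE nth_expo_of. Qed.

Lemma mnm_ofK e : size e = 6%N -> expo_of (mnm_of e) = e.
Proof.
move=> sze; apply: (@eq_from_nth _ 0%N); rewrite size_expo_of // => k ltk.
by rewrite (nth_expo_of _ (Ordinal ltk)) mnmE.
Qed.

Lemma sumn_expo_of x : sumn (expo_of x) = mdeg x.
Proof. by rewrite sumnE big_map big_enum mdegE. Qed.

Lemma mdeg_mnm_of e : size e = 6%N -> mdeg (mnm_of e) = sumn e.
Proof. by move=> sze; rewrite -sumn_expo_of mnm_ofK. Qed.

(** * Every form of degree at least 4 is congruent to a combination of standard monomials *)

Section Spanning.
Variables (K : fieldType) (i gamma : K).
Hypotheses (charK0 : [pchar K] =i pred0) (i2 : i ^+ 2 = -1) (gamma0 : gamma != 0).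
Local Notation I := (line_scheme_ideal i gamma).

Lemma seval_M_env (p : spoly) : {in p, forall t, size t.2 = 8%N} ->
  seval (M_env i gamma) p =
  \sum_(t <- p) (t.1%:~R * i ^+ nth 0%N t.2 0 * gamma ^+ nth 0%N t.2 1)
                  *: 'X_[mnm_of (drop 2 t.2)].
Proof.
move=> szp; rewrite /seval big_seq [RHS]big_seq; apply: eq_bigr => -[c e].
move=> /szp /=; case: e => [|j [|k e]] //= [sze]; rewrite drop0.
rewrite -!mul_mpolyC !rmorphM !rmorphXn rmorph_int /= !mulrA; congr (_ * _).
case: e sze => [|a [|b [|c' [|d [|e [|f []]]]]]] //= _.
by rewrite mpolyXE_id !big_ord_recl big_ord0 !mnmE.
Qed.

Lemma rule_mem r : rule_ok r -> I (seval (M_env i gamma) (rule_poly r)).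
Proof.
case/and4P => _ ltr _ _; rewrite seval_collect (seval_reduce _ _ (mpolyC_i2 i2 6)).
rewrite seval_cat seval_flatten big_map seval_mul; apply: ideal_genD.
  apply: ideal_gen_sum => s /(allP ltr) lts; rewrite seval_mul.
  apply/ideal_genMl/ideal_gen_gen/minor_generator => //.
  by apply: (allP minor_data_ok); apply: mem_nth.
apply/ideal_genMl/ideal_gen_gen; left; exact: seval_plucker.
Qed.

Definition std_mpoly (m : nat) (g : {mpoly K[6]}) : Prop :=
  {in msupp g, forall x, mdeg x = m /\ std (expo_of x)}.

Definition reducible (m : nat) (f : {mpoly K[6]}) : Prop :=
  exists2 g, std_mpoly m g & I (f - g).

Lemma reducible0 m : reducible m 0.
Proof.
exists 0; first by move=> x; rewrite msupp0.
by rewrite subrr; apply: ideal_gen0.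
Qed.

Lemma reducibleD m f g : reducible m f -> reducible m g -> reducible m (f + g).
Proof.
move=> [f' stdf If] [g' stdg Ig]; exists (f' + g'); last first.
  by rewrite opprD addrACA; apply: ideal_genD.
by move=> x /msuppD_le; rewrite mem_cat => /orP[/stdf|/stdg].
Qed.

Lemma reducibleZ m c f : reducible m f -> reducible m (c *: f).
Proof.
move=> [g stdg Ig]; exists (c *: g); last first.
  by rewrite -scalerBr -mul_mpolyC; apply: ideal_genMl.
by move=> x /msuppZ_le /stdg.
Qed.

Lemma reducible_sum m (T : eqType) (r : seq T) (F : T -> {mpoly K[6]}) :
  {in r, forall x, reducible m (F x)} -> reducible m (\sum_(x <- r) F x).
Proof.
move=> RF; rewrite big_seq; elim/big_ind: _ => //; first exact: reducible0.
exact: reducibleD.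
Qed.

Lemma reducible_congr m f g : I (f - g) -> reducible m g -> reducible m f.
Proof.
move=> Ifg [h stdh Ih]; exists h => //.
by rewrite -[f - h](subrKA g); apply: ideal_genD.
Qed.

(** Induction on the weight. The weight is additive, so multiplying a rule by a monomial y keeps its
    leading term strictly heavier than the others, and the rules are homogeneous, so the degree
    stays the same. *)
Lemma reducibleX x : (4 <= mdeg x)%N -> reducible (mdeg x) 'X_[x].
Proof.
have [n] := ubnP (weight (expo_of x)); elim: n x => // n IH x; rewrite ltnS => wtx degx.
have := @std_or_reducible (expo_of x); rewrite size_expo_of sumn_expo_of.
case=> // [stdx|[r r_in dvdr]].
  exists 'X_[x]; last by rewrite subrr; apply: ideal_gen0.
  by move=> y; rewrite msuppX inE => /eqP ->.
have ok_r := allP rule_data_ok r r_in; have Ir := rule_mem ok_r.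
move: ok_r => /and4P[/eqP szL _ tails lead].
set L := r.1.1 in szL dvdr tails lead; set S := rule_poly r in Ir tails lead.
pose y := (x - mnm_of L)%MM.
have xE : x = (y + mnm_of L)%MM.
  rewrite submK //; apply/mnm_lepP => j; rewrite mnmE -nth_expo_of.
  by apply: (allP dvdr); rewrite mem_iota /=.
have sz8 : {in S, forall t, size t.2 = 8%N} by move=> t /(allP tails) /and3P[/eqP].
rewrite seval_M_env // (bigID (fun t => drop 2 t.2 == L)) /= in Ir.
rewrite -big_filter in Ir.
case E: [seq t <- S | drop 2 t.2 == L] lead Ir => [|t0 [|t1 s]] //; last first.
  by case: t0 {E} => -[[|c]|c] [|[|j] e].
move=> lead; rewrite big_seq1 => Ir.
have /andP[/eqP t0L t0S] : (drop 2 t0.2 == L) && (t0 \in S).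
  by rewrite -(mem_filter (fun t => drop 2 t.2 == L)) E mem_head.
set c0 : K := t0.1%:~R * _ * _ in Ir.
have c0_neq0 : c0 != 0.
  rewrite /c0; case: t0 lead {E c0 Ir t0L t0S} => -[[|c]|c] [|[|j] e] //= _.
  rewrite expr0 mulr1 mulf_neq0 ?expf_neq0 //.
  by rewrite -pmulrn; move/pcharf0P: charK0 => ->.
have -> : 'X_[x] = c0^-1 *: (c0 *: 'X_[y] * 'X_[mnm_of L]) :> {mpoly K[6]}.
  by rewrite -scalerAl scalerA mulVf // scale1r -mpolyXD -xE.
apply: reducibleZ; rewrite t0L in Ir.
(* The leading term c0 X^L of the rule is congruent to - T, the negative of its tail. *)
set T := (X in I (_ + X)) in Ir; apply: (@reducible_congr _ _ (- 'X_[y] * T)).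
  by rewrite mulNr opprK -scalerAl scalerAr -mulrDr; apply: ideal_genMl.
rewrite /T mulr_sumr big_seq_cond; apply: big_ind.
- exact: reducible0.
- exact: reducibleD.
move=> t /andP[/(allP tails)/and3P[/eqP szt /eqP degt ltwt] /negPf neqL].
rewrite neqL /= in ltwt; rewrite -scalerAr mulNr -mpolyXD -scaleN1r.
have szd : size (drop 2 t.2) = 6%N by rewrite size_drop szt.
have degE : mdeg (y + mnm_of (drop 2 t.2))%MM = mdeg x.
  by rewrite xE !mdegD !mdeg_mnm_of // degt.
do 2 apply: reducibleZ; rewrite -degE; apply: IH; last by rewrite degE.
apply: leq_trans wtx; rewrite xE /weight.
have nthD z e : size e = 6%N -> forall k, (k < 6)%N ->
    nth 0%N (expo_of (z + mnm_of e)%MM) k = (nth 0 (expo_of z) k + nth 0 e k)%N.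
  move=> _ k ltk; rewrite !(nth_expo_of _ (Ordinal ltk)) mnmDE mnmE.
  by [].
rewrite !nthD //; move: ltwt; rewrite /weight !mulnDr.
by rewrite [X in _ -> (X < _)%N]addnACA [X in _ -> (_ < X)%N]addnACA ltn_add2l.
Qed.

Lemma homog_reducible m f : (4 <= m)%N -> f \is m.-homog -> reducible m f.
Proof.
move=> le4 /dhomogP homf; rewrite [f]mpolyE; apply: reducible_sum => x xf.
by apply: reducibleZ; rewrite -(homf x xf); apply: reducibleX; rewrite homf.
Qed.

End Spanning.

(** * Points of the line scheme *)

Definition pt (K : Type) (a b c d e f : K) (j : 'I_6) : K :=
  nth a [:: a; b; c; d; e; f] j.

Section Points.
Variables (K : fieldType) (i gamma : K).

Definition zero_pt (p : 'I_6 -> K) : Prop :=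
  forall F, line_scheme_ideal i gamma F -> F.@[p] = 0.

(* u and v span the line with coordinates a, .., f; (x, y) is in the kernel of the
   matrix of that line. *)
Lemma kernel_zero_pt (u1 u2 u3 u4 v1 v2 v3 v4 x1 x2 x3 x4 y1 y2 y3 y4 : K)
    (a b c d e f : K) :
  [/\ a = u3 * v4 - u4 * v3, b = - (u2 * v4 - u4 * v2) & c = u2 * v3 - u3 * v2] ->
  [/\ d = u1 * v4 - u4 * v1, e = - (u1 * v3 - u3 * v1) & f = u1 * v2 - u2 * v1] ->
  [|| x1 != 0, x2 != 0, x3 != 0, x4 != 0, y1 != 0, y2 != 0, y3 != 0 | y4 != 0] ->
  [/\ u1 * x2 + v1 * y2 = 0, u2 * x1 + v2 * y1 = 0, u3 * x4 + v3 * y4 = 0,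
      u4 * x3 + v4 * y3 = 0 & u3 * x1 + u1 * x3 + v3 * y1 + v1 * y3 = 0] ->
  [/\ u4 * x2 + u2 * x4 + v4 * y2 + v2 * y4 = 0,
      - u4 * x1 + i * u1 * x4 - v4 * y1 + i * v1 * y4 = 0,
      - u3 * x2 + i * u2 * x3 - v3 * y2 + i * v2 * y3 = 0,
      u1 * x1 + u3 * x3 + gamma * u2 * x4 +
        v1 * y1 + v3 * y3 + gamma * v2 * y4 = 0 &
      u2 * x2 + u1 * x3 + u4 * x4 + v2 * y2 + v1 * y3 + v4 * y4 = 0] ->
  zero_pt (pt a b c d e f).
Proof.
move=> [-> -> ->] [-> -> ->] {a b c d e f} w_neq0 [r0 r1 r2 r3 r4] [r5 r6 r7 r8 r9].
move=> _ [s [sG ->]]; rewrite rmorph_sum big_seq big1 // => -[h F] /sG /= FG.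
rewrite mevalM; set p := pt _ _ _ _ _ _; suff -> : F.@[p] = 0 by rewrite mulr0.
rewrite {}/p.
case: FG => [->|[rows [Q [_ _ QN ->]]]] {s sG h}.
  by rewrite !(mevalD, mevalN, mevalM) /= !mevalXU /pt /=; ring.
pose uv (j : 'I_8) := nth 0 [:: u1; u2; u3; u4; v1; v2; v3; v4] j.
rewrite comp_mpoly_meval.
(* [N_to_M] passes to the complementary pair of indices with a sign, and so do the coordinates
   chosen for the point: evaluating Q there amounts to evaluating the minor at (u, v). *)
have -> : Q.@[fun j => (tnth (N_to_M K) j).@[pt (u3 * v4 - u4 * v3)
    (- (u2 * v4 - u4 * v2)) (u2 * v3 - u3 * v2) (u1 * v4 - u4 * v1)
    (- (u1 * v3 - u3 * v1)) (u1 * v2 - u2 * v1)]] = (Q \mPo N_uv K).@[uv].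
  rewrite comp_mpoly_meval; apply: meval_eq => j; rewrite !(tnth_nth 0).
  case: j => [[|[|[|[|[|[|]]]]]]] //= _;
    by rewrite !(mevalD, mevalN, mevalM) /= !mevalXU /pt /uv /= ?opprK.
(* The same kernel vector serves every choice of eight rows. [det0P] asks for a row vector, hence
   the transpose. *)
rewrite QN -det_map_mx -det_tr; apply/eqP/det0P.
exists (\row_j nth 0 [:: x1; x2; x3; x4; y1; y2; y3; y4] j).
  apply/eqP => /rowP w0.
  have {w0} w0 k (ltk : (k < 8)%N) := w0 (Ordinal ltk).
  move: (w0 0%N isT) (w0 1%N isT) (w0 2%N isT) (w0 3%N isT) (w0 4%N isT).
  move: (w0 5%N isT) (w0 6%N isT) (w0 7%N isT); rewrite !mxE /=.
  move=> e5 e6 e7 e0 e1 e2 e3 e4; move: w_neq0.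
  by rewrite e0 e1 e2 e3 e4 e5 e6 e7 !eqxx.
apply/rowP => r; rewrite !mxE !big_ord_recl big_ord0 !mxE /=.
case: (rows r) => -[|[|[|[|[|[|[|[|[|[|//]]]]]]]]]] /= _;
  rewrite !(mevalN, meval0, mevalZ, mevalXU) /uv /=;
  [rewrite -[RHS]r0 | rewrite -[RHS]r1 | rewrite -[RHS]r2 | rewrite -[RHS]r3
  |rewrite -[RHS]r4 | rewrite -[RHS]r5 | rewrite -[RHS]r6 | rewrite -[RHS]r7
  |rewrite -[RHS]r8 | rewrite -[RHS]r9]; ring.
Qed.
End Points.

(** Ideal membership with explicit cofactors, so that [ring] can prove identities that hold only
    modulo two equations, such as the equation of a curve and i^2 + 1 = 0. *)
Lemma eq0_by_combination (R : comNzRingType) (k l p q e : R) :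
  p = 0 -> q = 0 -> e = k * p + l * q -> e = 0.
Proof. by move=> -> -> ->; rewrite !mulr0 addr0. Qed.

Section Curves.
Variables (K : fieldType) (i gamma : K).
Hypothesis i2 : i ^+ 2 = -1.
Local Notation zero_pt := (zero_pt i gamma).

Let i2D1 : i ^+ 2 + 1 = 0. Proof. by rewrite i2 addNr. Qed.

(** The chart e = 1, d = t of the cubic a^3 - a d^2 - i d e^2 = 0 in the plane b = c = f = 0. In
    this lemma and the next five, the first eight scalars span the line and the other eight form the
    kernel vector. The kernel equations that survive [try ring] are those that hold only on the
    curve or modulo i^2 + 1. *)
Lemma zero_pt_de t a : t != 0 -> a ^+ 3 - a * t ^+ 2 + (- i) * t = 0 ->
  zero_pt (pt a 0 0 t 1 0).
Proof.
move=> t0 h; apply: (@kernel_zero_pt _ _ _ 1 0 0 a 0 0 (-1) t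
  (a ^+ 2) 0 (- (a * t)) t (- (a * t)) 0 (a ^+ 2) 0);
  [split; ring | split; ring | by rewrite t0 !orbT | split; ring | split; try ring].
by apply: (eq0_by_combination (k := -1) (l := 0) h i2D1); ring.
Qed.

Lemma zero_pt_bc t a : t != 0 -> a ^+ 3 - a * t ^+ 2 + (i * gamma) * t = 0 ->
  zero_pt (pt a 1 t 0 0 0).
Proof.
move=> t0 h; apply: (@kernel_zero_pt _ _ _ 0 1 (- a) 0 0 0 t (-1)
  0 a (i * (a ^+ 2 - t ^+ 2)) t 0 t 0 a);
  [split; ring | split; ring | by rewrite t0 !orbT | split; ring | split; try ring].
- by apply: (eq0_by_combination (k := 0) (l := a ^+ 2 - t ^+ 2) h i2D1); ring.
- by apply: (eq0_by_combination (k := - i) (l := gamma * t) h i2D1); ring.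
Qed.

Lemma zero_pt_ce t f : t != 0 -> f ^+ 3 - f * t ^+ 2 + i * t = 0 ->
  zero_pt (pt 0 0 t 0 1 f).
Proof.
move=> t0 h; apply: (@kernel_zero_pt _ _ _ 1 (- t) 0 0 0 f (-1) 0
  f 0 t 0 t (i * (t ^+ 2 - f ^+ 2)) f 0);
  [split; ring | split; ring | by rewrite t0 !orbT | split; ring | split; try ring].
by apply: (eq0_by_combination (k := - i) (l := t) h i2D1); ring.
Qed.

Lemma zero_pt_bd t f : t != 0 -> f ^+ 3 - f * t ^+ 2 + (- (i * gamma)) * t = 0 ->
  zero_pt (pt 0 1 0 t 0 f).
Proof.
move=> t0 h; apply: (@kernel_zero_pt _ _ _ (- t) 1 0 0 (- f) 0 0 (-1)
  0 (- f) 0 t (i * (t ^+ 2 - f ^+ 2)) t 0 (- f));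
  [split; ring | split; ring | by rewrite t0 !orbT | split; ring | split; try ring].
by apply: (eq0_by_combination (k := i) (l := gamma * t) h i2D1); ring.
Qed.

Lemma zero_pt_cd t a f : t != 0 -> a * f = - t ->
  a ^+ 2 + f ^+ 2 - gamma * (a * f) = t ^+ 2 + 1 ->
  zero_pt (pt a 0 t 1 0 f).
Proof.
move=> t0 af h; have tE : t = - (a * f) by rewrite af opprK.
have a0 : a != 0 by apply: contra t0 => /eqP a0; rewrite tE a0 mul0r oppr0.
move: h; rewrite tE => /eqP; rewrite -subr_eq0 => /eqP h.
apply: (@kernel_zero_pt _ _ _ 1 0 a 0 0 f 0 1
  (1 - f ^+ 2) 0 (- a * (1 - f ^+ 2)) 0 0 (- f * a) 0 a);
  [split; ring | split; ring | by rewrite a0 !orbT | split; ring | split; try ring].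
by apply: (eq0_by_combination (k := -1) (l := 0) h i2D1); ring.
Qed.

Lemma zero_pt_be t a f : a * f = t -> a ^+ 2 + f ^+ 2 = 0 ->
  zero_pt (pt a t 0 0 1 f).
Proof.
move=> <- h; apply: (@kernel_zero_pt _ _ _ 1 0 0 a 0 f (-1) 0
  1 0 0 (- i * a) 0 (- i * f) 1 0);
  [split; ring | split; ring | by rewrite oner_eq0 | split; ring | split; try ring].
- by apply: (eq0_by_combination (k := 0) (l := - a) h i2D1); ring.
- by apply: (eq0_by_combination (k := - i) (l := 0) h i2D1); ring.
Qed.

End Curves.

(** * Independence of the standard monomials *)

Section Fibres.
Variable K : closedFieldType.
Hypothesis charK0 : [pchar K] =i pred0.

Lemma natr_neq0 n : (n.+1%:R : K) != 0.
Proof. by move/pcharf0P: charK0 => ->. Qed.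

(** If Gh were nonzero, then GhX + 1 would be nonconstant, and at a root of it neither G nor h could
    vanish. *)
Lemma poly_eq0_generic (h G : {poly K}) :
  h != 0 -> (forall t, h.[t] != 0 -> G.[t] = 0) -> G = 0.
Proof.
move=> h0 Gh; suff /eqP : G * h = 0 by rewrite mulf_eq0 (negPf h0) orbF => /eqP.
apply/eqP/negPn/negP => Gh0.
have /closed_rootP[x] : size (G * h * 'X + 1%:P) != 1%N.
  by rewrite size_MXaddC (negPf Gh0) eqSS size_poly_eq0.
rewrite rootE !hornerE; have [->|/Gh ->] := eqVneq h.[x] 0.
  by rewrite mulr0 mul0r add0r oner_eq0.
by rewrite !mul0r add0r oner_eq0.
Qed.

Lemma sqrt_exists (c : K) : exists x, x ^+ 2 = c.
Proof.
have /closed_rootP[x] : size ('X^2 - c%:P) != 1%N by rewrite size_XnsubC.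
by rewrite rootE !hornerE subr_eq0 => /eqP; exists x.
Qed.

Lemma cubic_fibre (p q a b c : K) : 4 * p ^+ 3 + 27 * q ^+ 2 != 0 ->
  (forall x, x ^+ 3 + p * x + q = 0 -> a + b * x + c * x ^+ 2 = 0) ->
  [/\ a = 0, b = 0 & c = 0].
Proof.
move=> disc fib; have two0 := natr_neq0 1; have four0 := natr_neq0 3.
have [r1 /eqP r1F] : exists r, r ^+ 3 + p * r + q == 0.
  have /closed_rootP[r] : size ('X^3 + (p *: 'X + q%:P)) != 1%N.
    rewrite size_polyDl size_polyXn //.
    rewrite (leq_ltn_trans (size_polyD _ _)) // gtn_max size_polyC.
    rewrite (leq_ltn_trans (size_scale_leq _ _)) ?size_polyX //.
    by case: (q != 0).
  by rewrite rootE !(hornerD, hornerXn, hornerZ, hornerX, hornerC) addrA; exists r.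
(* The quotient of the cubic by x - r1 is x^2 + r1 x + (r1^2 + p). Its discriminant is s^2, and r2,
   r3 are its roots. *)
have [s s2] := sqrt_exists (- 3 * r1 ^+ 2 - 4 * p).
pose r2 := (- r1 + s) / 2; pose r3 := (- r1 - s) / 2.
have pE : p = (- 3 * r1 ^+ 2 - s ^+ 2) / 4.
  by rewrite s2; field.
have qE : q = - r1 ^+ 3 - p * r1.
  by rewrite -opprD; apply/eqP; rewrite -addr_eq0 addrC r1F.
have r2F : r2 ^+ 3 + p * r2 + q = 0 by rewrite qE pE /r2; field; rewrite two0 four0.
have r3F : r3 ^+ 3 + p * r3 + q = 0 by rewrite qE pE /r3; field; rewrite two0 four0.
(* minus the discriminant of the cubic *)
have discE : 4 * p ^+ 3 + 27 * q ^+ 2 =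
    - ((r1 - r2) * (r2 - r3) * (r1 - r3)) ^+ 2.
  by rewrite qE pE /r2 /r3; field; rewrite two0 four0.
move: disc; rewrite discE oppr_eq0 expf_eq0 /= !mulf_eq0 !negb_or.
case/andP=> /andP[d12 d23] d13.
have h1 := fib _ r1F; have h2 := fib _ r2F; have h3 := fib _ r3F.
(* Divided differences of a + b x + c x^2, which vanishes at three distinct points. *)
have e12 : b + c * (r1 + r2) = 0.
  by apply: (mulfI d12); rewrite mulr0; apply: (eq0_by_combination (k := 1) (l := -1) h1 h2); ring.
have e13 : b + c * (r1 + r3) = 0.
  by apply: (mulfI d13); rewrite mulr0; apply: (eq0_by_combination (k := 1) (l := -1) h1 h3); ring.
have c0 : c = 0.
  by apply: (mulfI d23); rewrite mulr0; apply: (eq0_by_combination (k := 1) (l := -1) e12 e13); ring.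
have b0 : b = 0 by move: e12; rewrite c0 mul0r addr0.
by split=> //; move: h1; rewrite c0 b0 !mul0r !addr0.
Qed.
End Fibres.

(** The order within a pair matters: the curves are taken in the chart where the second coordinate
    is 1, and the first one is the parameter t. *)
Definition edges : seq (nat * nat) :=
  [:: (2, 3); (1, 4); (3, 4); (2, 1); (2, 4); (3, 1)]%N.

Definition weights : seq (nat * nat) :=
  [:: (0, 0); (1, 0); (2, 0); (0, 1); (0, 2)]%N.

Lemma std_edge s : s \in std_edges -> (s.1 \in weights) && (s.2 \in edges).
Proof. exact: (@allP _ (fun s => (s.1 \in weights) && (s.2 \in edges)) std_edges isT). Qed.

(** * Restriction of standard forms to the six curves *)

Section FibrePolynomials.
Variables (K : fieldType) (m : nat) (f : {mpoly K[6]}).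
Hypothesis stdf : std_mpoly m f.

(** For s = (w, (y, z)), this is the coefficient of w in f after setting z = 1 and the other two of
    b, c, d, e to 0, as a polynomial in y. *)
Definition fibre_poly (s : nat * nat * (nat * nat)) : {poly K} :=
  \sum_(x <- msupp f | std_at s (expo_of x)) f@_x *: 'X^(nth 0%N (expo_of x) s.2.1).

(** The total degree recovers the exponent of z lost by setting z = 1. Hence each coefficient of
    [fibre_poly] is a single coefficient of f. *)
Lemma std_at_inj s x x' : s.2 \in edges -> mdeg x = mdeg x' ->
  std_at s (expo_of x) -> std_at s (expo_of x') ->
  nth 0%N (expo_of x) s.2.1 = nth 0%N (expo_of x') s.2.1 -> x = x'.
Proof.
rewrite -!sumn_expo_of => yz deg std_x std_x' ey; apply: (can_inj expo_ofK).
move: deg std_x std_x' ey; rewrite /std_at.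
case: (expo_of x) (size_expo_of x) => [|a [|b [|c [|d [|e [|g []]]]]]] //= _.
case: (expo_of x') (size_expo_of x') => [|a' [|b' [|c' [|d' [|e' [|g' []]]]]]] //= _.
case: s yz => [[w1 w2] [y z]] /= yz deg.
move=> /and3P[/eqP ea /eqP eg H] /and3P[/eqP ea' /eqP eg' H'] ey.
move: yz H H' ey; rewrite !inE.
by do ![case/orP]; move=> /eqP[-> ->] /= H H' ey;
  do !congr (_ :: _); lia.
Qed.

Lemma fibre_poly_eq0 s : s.2 \in edges -> fibre_poly s = 0 ->
  {in msupp f, forall x, ~~ std_at s (expo_of x)}.
Proof.
move=> s_in fp0 x xf; apply/negP => std_x.
have /negP[] : f@_x != 0 by rewrite -mcoeff_msupp.
have := congr1 (fun P : {poly K} => P`_(nth 0%N (expo_of x) s.2.1)) fp0.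
rewrite coef0 coef_sum -big_filter (bigD1_seq x) ?mem_filter ?std_x ?filter_uniq //=.
rewrite coefZ coefXn eqxx mulr1.
rewrite big_seq_cond big1 ?addr0 => [->//|x'].
rewrite mem_filter -andbA => /and3P[std_x' x'f neq_x'x].
rewrite coefZ coefXn; case: eqP => [e|_]; last by rewrite mulr0.
case/eqP: neq_x'x; apply: (std_at_inj s_in) => //.
by have [-> _] := stdf xf; have [-> _] := stdf x'f.
Qed.

(** At most one summand is nonzero: w is determined by the exponents of a and f, and a monomial
    involving another of b, c, d, e vanishes at the point. *)
Lemma mon_fibre (l : seq K) y z e : (y, z) \in edges -> size l = 6%N ->
  size e = 6%N -> (nth 0%N e 0, nth 0%N e 5) \in weights -> nth 0 l z = 1 ->
  all (fun k => [|| k == y, k == z | nth 0 l k == 0]) [:: 1; 2; 3; 4]%N ->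
  \prod_(k < 6) nth 0 l k ^+ nth 0%N e k =
  \sum_(w <- weights) if std_at (w, (y, z)) e
    then nth 0 l 0 ^+ w.1 * nth 0 l 5 ^+ w.2 * nth 0 l y ^+ nth 0%N e y else 0.
Proof.
case: l => [|v0 [|v1 [|v2 [|v3 [|v4 [|v5 []]]]]]] //= yz _.
case: e => [|a [|b [|c [|d [|e [|g []]]]]]] //= _ w; move: yz w.
rewrite !big_ord_recl big_ord0 /= mulr1 /weights !big_cons big_nil /std_at /=.
rewrite !inE => yz w.
by move: yz; do ![case/orP]; move=> /eqP[-> ->] /= ->; rewrite ?andbT;
  do 1?[case/andP => /eqP ->]; move=> /eqP ->; rewrite !expr0n;
  rewrite expr1n; move: w; do ![case/orP]; move=> /eqP[-> ->] /=;
  case: (_ == 0%N); case: (_ == 0%N) => /=; ring.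
Qed.
End FibrePolynomials.

Section Independence.
Variable K : closedFieldType.
Hypothesis charK0 : [pchar K] =i pred0.
Variables (i gamma : K).
Hypotheses (i2 : i ^+ 2 = -1) (gamma0 : gamma != 0).

Lemma meval_fibre m (f : {mpoly K[6]}) y z (a b c d e g : K) :
  let l := [:: a; b; c; d; e; g] in
  std_mpoly m f -> (y, z) \in edges -> nth 0 l z = 1 ->
  all (fun k => [|| k == y, k == z | nth 0 l k == 0]) [:: 1; 2; 3; 4]%N ->
  f.@[pt a b c d e g] = \sum_(w <- weights)
    a ^+ w.1 * g ^+ w.2 * (fibre_poly f (w, (y, z))).[nth 0 l y].
Proof.
move=> l stdf yz lz l0; rewrite mevalE.
transitivity (\sum_(w <- weights) \sum_(x <- msupp f)
   if std_at (w, (y, z)) (expo_of x)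
   then f@_x * (a ^+ w.1 * g ^+ w.2 * nth 0 l y ^+ nth 0%N (expo_of x) y) else 0).
  rewrite exchange_big; apply: eq_big_seq => x xf.
  have [_ /hasP[s /std_edge/andP[w_in _] /and3P[/eqP w1 /eqP w2 _]]] := stdf x xf.
  have w_in' : (nth 0%N (expo_of x) 0, nth 0%N (expo_of x) 5) \in weights.
    by rewrite w1 w2 -surjective_pairing.
  have := mon_fibre yz (erefl : size l = 6%N) (size_expo_of x) w_in' lz l0.
  have -> : \prod_(k < 6) nth 0 l k ^+ nth 0%N (expo_of x) k =
            \prod_(k < 6) pt a b c d e g k ^+ x k.
    apply: eq_bigr => k _; rewrite nth_expo_of; congr (_ ^+ _).
    by rewrite /pt; apply: set_nth_default; rewrite ltn_ord.
  move=> ->; rewrite mulr_sumr; apply: eq_bigr => w _.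
  by case: ifP; rewrite ?mulr0.
apply: eq_bigr => w _; rewrite /fibre_poly horner_sum mulr_sumr -big_mkcond.
by apply: eq_bigr => x _; rewrite hornerZ hornerXn mulrCA !mulrA.
Qed.

Lemma cubic_edge (kappa : K) (G0 G1 G2 : {poly K}) : kappa != 0 ->
  (forall t x, t != 0 -> x ^+ 3 - x * t ^+ 2 + kappa * t = 0 ->
     G0.[t] + G1.[t] * x + G2.[t] * x ^+ 2 = 0) ->
  [/\ G0 = 0, G1 = 0 & G2 = 0].
Proof.
move=> k0 H; pose h := 'X * ((27 * kappa ^+ 2)%:P - 4 *: 'X^4).
have h0 : h != 0.
  rewrite mulf_neq0 ?polyX_eq0 //; apply/eqP => /(congr1 (fun P : {poly K} => P.[0])).
  rewrite !(hornerD, hornerN, hornerZ, hornerXn, hornerC) expr0n mulr0 subr0.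
  move/eqP.
  by rewrite mulf_eq0 expf_eq0 (negPf k0) (negPf (natr_neq0 charK0 26)).
suff G t : h.[t] != 0 -> [/\ G0.[t] = 0, G1.[t] = 0 & G2.[t] = 0].
  by split; apply: (poly_eq0_generic h0) => t /G[].
rewrite /h !(hornerM, hornerX, hornerD, hornerN, hornerZ, hornerXn, hornerC) mulf_eq0 negb_or => /andP[t0 disc].
apply: (@cubic_fibre _ charK0 (- t ^+ 2) (kappa * t)).
  suff -> : 4 * (- t ^+ 2) ^+ 3 + 27 * (kappa * t) ^+ 2 =
     t ^+ 2 * (27 * kappa ^+ 2 - 4 * t ^+ 4) by rewrite mulf_neq0 ?expf_neq0.
  ring.
by move=> x; rewrite mulNr [t ^+ 2 * x]mulrC => /(H t x t0).
Qed.

Variables (m : nat) (f : {mpoly K[6]}).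
Hypotheses (stdf : std_mpoly m f)
  (f0 : forall p, zero_pt i gamma p -> f.@[p] = 0).
Local Notation G a b y z := (fibre_poly f ((a%N, b%N), (y%N, z%N))).

Lemma i_neq0 : i != 0.
Proof.
apply/eqP => i0; move/eqP: i2.
by rewrite i0 expr0n eq_sym oppr_eq0 oner_eq0.
Qed.

Lemma fibre_de : [/\ G 0 0 3 4 = 0, G 1 0 3 4 = 0 & G 2 0 3 4 = 0].
Proof.
apply: (@cubic_edge (- i)); first by rewrite oppr_eq0 i_neq0.
move=> t x t0 /(zero_pt_de i2 t0)/f0.
rewrite (@meval_fibre m f 3 4) //=; last by rewrite !eqxx.
by rewrite /weights !big_cons big_nil /= => <-; ring.
Qed.

Lemma fibre_bc : [/\ G 0 0 2 1 = 0, G 1 0 2 1 = 0 & G 2 0 2 1 = 0].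
Proof.
apply: (@cubic_edge (i * gamma)); first by rewrite mulf_neq0 ?i_neq0.
move=> t x t0 /(zero_pt_bc i2 t0)/f0.
rewrite (@meval_fibre m f 2 1) //=; last by rewrite !eqxx.
by rewrite /weights !big_cons big_nil /= => <-; ring.
Qed.

Lemma fibre_ce : [/\ G 0 0 2 4 = 0, G 0 1 2 4 = 0 & G 0 2 2 4 = 0].
Proof.
apply: (@cubic_edge i); first exact: i_neq0.
move=> t x t0 /(zero_pt_ce i2 t0)/f0.
rewrite (@meval_fibre m f 2 4) //=; last by rewrite !eqxx.
by rewrite /weights !big_cons big_nil /= => <-; ring.
Qed.

Lemma fibre_bd : [/\ G 0 0 3 1 = 0, G 0 1 3 1 = 0 & G 0 2 3 1 = 0].
Proof.
apply: (@cubic_edge (- (i * gamma))).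
  by rewrite oppr_eq0 mulf_neq0 ?i_neq0.
move=> t x t0 /(zero_pt_bd i2 t0)/f0.
rewrite (@meval_fibre m f 3 1) //=; last by rewrite !eqxx.
by rewrite /weights !big_cons big_nil /= => <-; ring.
Qed.

(** A standard monomial with a^2 belongs to {d, e} or {b, c}, where its coefficient is already known
    to vanish. This leaves four unknowns on each of the fibres with four points below. *)
Lemma fibre_a2 y z : G 2 0 y z = 0.
Proof.
rewrite /fibre_poly big_seq_cond big1 // => x /andP[xf std_x].
have [de bc] : ~~ std_at (2, 0, (3, 4))%N (expo_of x) /\
               ~~ std_at (2, 0, (2, 1))%N (expo_of x).
  have [_ _ de] := fibre_de; have [_ _ bc] := fibre_bc.
  by split; [exact: (fibre_poly_eq0 stdf _ de) | exact: (fibre_poly_eq0 stdf _ bc)].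
have [_ std_ex] := stdf xf; move: de bc std_ex.
case/and3P: std_x => /= /eqP a2 /eqP g0 _; rewrite /std /std_at /= a2 g0 /=.
by move=> /negPf -> /negPf ->.
Qed.

(** The two equations of the curve fix (a + f)^2 = U(t) and (a - f)^2 = V(t). Where neither
    vanishes, independent signs of the square roots s and r give the four points of the fibre.
    Differences of opposite points isolate the coefficients of a and f; then two points with
    different f^2 separate 1 from f^2. *)
Lemma fibre_cd : [/\ G 0 0 2 3 = 0, G 1 0 2 3 = 0, G 0 1 2 3 = 0 & G 0 2 2 3 = 0].
Proof.
have two0 : (2 : K) != 0 := natr_neq0 charK0 1.
pose U : {poly K} := 'X^2 - (gamma + 2) *: 'X + 1%:P.
pose V : {poly K} := 'X^2 - (gamma - 2) *: 'X + 1%:P.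
have quad0 k : 'X^2 - k *: 'X + 1%:P != 0 :> {poly K}.
  apply/eqP => /(congr1 (fun P : {poly K} => P.[0])).
  rewrite !(hornerD, hornerN, hornerZ, hornerXn, hornerX, hornerC) expr0n mulr0.
  by rewrite subr0 add0r => /eqP; rewrite oner_eq0.
have h0 : 'X * (U * V) != 0 by rewrite !mulf_neq0 ?polyX_eq0 ?quad0.
suff H t : ('X * (U * V)).[t] != 0 -> [/\ (G 0 0 2 3).[t] = 0,
    (G 1 0 2 3).[t] = 0, (G 0 1 2 3).[t] = 0 & (G 0 2 2 3).[t] = 0].
  by split; apply: (poly_eq0_generic h0) => t /H[].
rewrite !hornerM hornerX !mulf_eq0 !negb_or => /and3P[t0].
rewrite !(hornerD, hornerN, hornerZ, hornerXn, hornerX, hornerC) => U0 V0.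
have [s s2] := sqrt_exists (t ^+ 2 - (gamma + 2) * t + 1).
have [r r2] := sqrt_exists (t ^+ 2 - (gamma - 2) * t + 1).
have s0 : s != 0 by move: U0; rewrite -s2 expf_eq0.
have r0 : r != 0 by move: V0; rewrite -r2 expf_eq0.
have fib a g : a + g = s \/ a + g = - s -> a - g = r \/ a - g = - r ->
  (G 0 0 2 3).[t] + (G 1 0 2 3).[t] * a + (G 0 1 2 3).[t] * g +
     (G 0 2 2 3).[t] * g ^+ 2 = 0.
  move=> hs hr; have {hs} hs : (a + g) ^+ 2 = s ^+ 2.
    by case: hs => ->; rewrite ?sqrrN.
  have {hr} hr : (a - g) ^+ 2 = r ^+ 2 by case: hr => ->; rewrite ?sqrrN.
  have ag : a * g = - t.
    apply/eqP; rewrite -subr_eq0 opprK; apply/eqP/(mulfI (natr_neq0 charK0 3)).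
    have -> : 4 * (a * g + t) = (a + g) ^+ 2 - (a - g) ^+ 2 + 4 * t by ring.
    by rewrite hs hr s2 r2; ring.
  have h : a ^+ 2 + g ^+ 2 - gamma * (a * g) = t ^+ 2 + 1.
    apply: (mulfI two0); rewrite ag.
    have -> : 2 * (a ^+ 2 + g ^+ 2 - gamma * - t) =
       (a + g) ^+ 2 + (a - g) ^+ 2 + 2 * gamma * t by ring.
    by rewrite hs hr s2 r2; ring.
  have := f0 (zero_pt_cd i2 t0 ag h).
  rewrite (@meval_fibre m f 2 3) //=; last by rewrite !eqxx.
  by rewrite /weights !big_cons big_nil /= fibre_a2 horner0 => <-; ring.
move: fib; set A := (G 0 0 2 3).[t]; set B := (G 1 0 2 3).[t].
set C := (G 0 1 2 3).[t]; set D := (G 0 2 2 3).[t] => fib.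
have pp : A + B * ((s + r) / 2) + C * ((s - r) / 2) + D * ((s - r) / 2) ^+ 2 = 0.
  by apply: fib; left; field.
have pm : A + B * ((s - r) / 2) + C * ((s + r) / 2) + D * ((s + r) / 2) ^+ 2 = 0.
  by apply: fib; [left | right]; field.
have mp : A + B * ((- s + r) / 2) + C * ((- s - r) / 2) + D * ((- s - r) / 2) ^+ 2 = 0.
  by apply: fib; [right | left]; field.
have mm : A + B * ((- s - r) / 2) + C * ((- s + r) / 2) + D * ((- s + r) / 2) ^+ 2 = 0.
  by apply: fib; [right | right]; field.
have e1 : B * (s + r) + C * (s - r) = 0.
  by apply: (eq0_by_combination (k := 1) (l := -1) pp mm); field.
have e2 : B * (s - r) + C * (s + r) = 0.
  by apply: (eq0_by_combination (k := 1) (l := -1) pm mp); field.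
have e3 : B + C = 0.
  apply: (mulfI (mulf_neq0 two0 s0)); rewrite mulr0.
  by apply: (eq0_by_combination (k := 1) (l := 1) e1 e2); ring.
have e4 : B - C = 0.
  apply: (mulfI (mulf_neq0 two0 r0)); rewrite mulr0.
  by apply: (eq0_by_combination (k := 1) (l := -1) e1 e2); ring.
have B0 : B = 0.
  apply: (mulfI two0); rewrite mulr0.
  by apply: (eq0_by_combination (k := 1) (l := 1) e3 e4); ring.
have C0 : C = 0 by move: e3; rewrite B0 add0r.
have D0 : D = 0.
  apply: (mulfI (mulf_neq0 s0 r0)); rewrite mulr0.
  apply: (eq0_by_combination (k := -1) (l := 1) pp pm); rewrite B0 C0; field.
  exact: two0.
by split=> //; move: pp; rewrite B0 C0 D0 !mul0r !addr0.
Qed.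

(** With s^2 = - i t, the solutions (a, f) of af = t, a^2 + f^2 = 0 are (is, s), (s, is) and their
    negatives. *)
Lemma fibre_be : [/\ G 0 0 1 4 = 0, G 1 0 1 4 = 0, G 0 1 1 4 = 0 & G 0 2 1 4 = 0].
Proof.
have two0 : (2 : K) != 0 := natr_neq0 charK0 1.
suff H t : ('X : {poly K}).[t] != 0 -> [/\ (G 0 0 1 4).[t] = 0,
    (G 1 0 1 4).[t] = 0, (G 0 1 1 4).[t] = 0 & (G 0 2 1 4).[t] = 0].
  by split; apply: (@poly_eq0_generic _ 'X); rewrite ?polyX_eq0 // => t /H[].
rewrite hornerX => t0; have [s s2] := sqrt_exists (- i * t).
have fib a g : a * g = t -> a ^+ 2 + g ^+ 2 = 0 ->
  (G 0 0 1 4).[t] + (G 1 0 1 4).[t] * a + (G 0 1 1 4).[t] * g +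
     (G 0 2 1 4).[t] * g ^+ 2 = 0.
  move=> ag h; have := f0 (zero_pt_be i2 ag h).
  rewrite (@meval_fibre m f 1 4) //=; last by rewrite !eqxx.
  by rewrite /weights !big_cons big_nil /= fibre_a2 horner0 => <-; ring.
have i2D1 : i ^+ 2 + 1 = 0 by rewrite i2 addNr.
have s2E : s ^+ 2 + i * t = 0 by rewrite s2; ring.
have s0 : s != 0.
  apply: contraTneq t0 => s0; apply/negPn; rewrite -(mulrI_eq0 _ (mulfI i_neq0)).
  by rewrite -oppr_eq0 -mulNr -s2 s0 expr0n.
have ist : i * s ^+ 2 = t.
  apply/eqP; rewrite -subr_eq0; apply/eqP.
  by apply: (eq0_by_combination (k := i) (l := - t) s2E i2D1); ring.
have iss : (i * s) ^+ 2 + s ^+ 2 = 0.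
  by apply: (eq0_by_combination (k := 0) (l := s ^+ 2) s2E i2D1); ring.
move: fib; set A := (G 0 0 1 4).[t]; set B := (G 1 0 1 4).[t].
set C := (G 0 1 1 4).[t]; set D := (G 0 2 1 4).[t] => fib.
have p1 : A + B * (i * s) + C * s + D * s ^+ 2 = 0.
  by apply: fib; rewrite // -ist; ring.
have p2 : A + B * (- (i * s)) + C * (- s) + D * (- s) ^+ 2 = 0.
  by apply: fib; rewrite ?sqrrN // -ist; ring.
have p3 : A + B * s + C * (i * s) + D * (i * s) ^+ 2 = 0.
  by apply: fib; rewrite 1?addrC // -ist; ring.
have p4 : A + B * (- s) + C * (- (i * s)) + D * (- (i * s)) ^+ 2 = 0.
  by apply: fib; rewrite ?sqrrN 1?addrC // -ist; ring.
have e1 : B * i + C = 0.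
  apply: (mulfI (mulf_neq0 two0 s0)); rewrite mulr0.
  by apply: (eq0_by_combination (k := 1) (l := -1) p1 p2); ring.
have e2 : B + C * i = 0.
  apply: (mulfI (mulf_neq0 two0 s0)); rewrite mulr0.
  by apply: (eq0_by_combination (k := 1) (l := -1) p3 p4); ring.
have B0 : B = 0.
  apply: (mulfI two0); rewrite mulr0.
  have e3 : 2 * B - B * (i ^+ 2 + 1) = 0.
    by apply: (eq0_by_combination (k := - i) (l := 1) e1 e2); ring.
  by move: e3; rewrite i2D1 mulr0 subr0.
have C0 : C = 0 by move: e1; rewrite B0 mul0r add0r.
have p1' : A + D * s ^+ 2 = 0 by rewrite -p1 B0 C0; ring.
have p3' : A - D * s ^+ 2 = 0.
  apply: (eq0_by_combination (k := 1) (l := - D * s ^+ 2) p3 i2D1).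
  by rewrite B0 C0; ring.
have A0 : A = 0.
  apply: (mulfI two0); rewrite mulr0.
  by apply: (eq0_by_combination (k := 1) (l := 1) p1' p3'); ring.
split=> //; apply: (mulIf (expf_neq0 2 s0)).
by move: p1'; rewrite A0 add0r mul0r.
Qed.

Lemma std_mpoly_eq0 : f = 0.
Proof.
apply/eqP; rewrite -msupp_eq0; apply/eqP.
case E: (msupp f) => [//|x r]; have xf : x \in msupp f by rewrite E mem_head.
have [_ /hasP[s s_in std_x]] := stdf xf.
have /andP[_ s2] := std_edge s_in.
suff fp0 : fibre_poly f s = 0 by have /negP[] := fibre_poly_eq0 stdf s2 fp0 xf.
have [? ? ?] := fibre_de; have [? ? ?] := fibre_bc; have [? ? ?] := fibre_ce.
have [? ? ?] := fibre_bd; have [? ? ? ?] := fibre_cd; have [? ? ? ?] := fibre_be.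
by move: s_in; rewrite !inE; do ![case/orP]; move=> /eqP ->.
Qed.

End Independence.

(** * Hilbert function *)

(** Since P is only a predicate, U has to be built: it is spanned by the differences between the
    vectors of a basis and their normal forms. Then U lies in P and U + W is everything, so P
    meeting W only in 0 forces U = P. *)
Lemma complement_of_normal_forms (K : fieldType) (V : vectType K) (P : V -> Prop)
    (W : {vspace V}) :
  P 0 -> (forall a u v, P u -> P v -> P (a *: u + v)) ->
  (forall v, exists2 w, w \in W & P (v - w)) ->
  (forall w, w \in W -> P w -> w = 0) ->
  exists U : {vspace V}, (forall v, v \in U <-> P v) /\
    \dim (fullv : {vspace V}) = (\dim U + \dim W)%N.
Proof.
move=> P0 Plin nfW PW0; pose b := vbasis (fullv : {vspace V}).
have /fin_all_exists[w wP] (j : 'I_(\dim (fullv : {vspace V}))) :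
    exists w, w \in W /\ P (b`_j - w) by have [w wW Pw] := nfW b`_j; exists w.
pose X := [tuple b`_j - w j | j < \dim (fullv : {vspace V})].
have PD u v : P u -> P v -> P (u + v) by move=> Pu; rewrite -[u]scale1r; apply: Plin.
have PZ a u : P u -> P (a *: u) by move=> Pu; rewrite -[_ *: _]addr0; apply: Plin.
have PX v : v \in <<X>>%VS -> P v.
  move=> /coord_span ->; apply: big_ind => // j _; apply: PZ.
  by rewrite -tnth_nth tnth_mktuple; case: (wP j).
have full : (<<X>> + W)%VS = fullv.
  apply/eqP; rewrite eqEsubv subvf /= -[X in (X <= _)%VS](span_basis (vbasisP fullv)).
  apply/span_subvP => _ /(nthP 0)[k ltk <-]; rewrite size_tuple in ltk.
  rewrite -[_`_k](subrK (w (Ordinal ltk))); apply: memv_add; last by case: (wP (Ordinal ltk)).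
  apply: memv_span; have := mem_tnth (Ordinal ltk) X.
  by rewrite tnth_mktuple.
exists <<X>>%VS; split=> [v|].
  split=> [|Pv]; first exact: PX.
  have : v \in (<<X>> + W)%VS by rewrite full memvf.
  case/memv_addP => u uX [x xW vE]; have x0 : x = 0.
    apply: PW0 => //; have -> : x = -1 *: u + v by rewrite vE scaleN1r addKr.
    by apply: Plin => //; apply: PX.
  by rewrite vE x0 addr0.
rewrite -[in LHS]full dimv_disjoint_sum //; apply/eqP; rewrite -subv0.
by apply/subvP => v; rewrite memv_cap memv0 => /andP[/PX Pv /PW0 ->].
Qed.

(** The map g reads off from an element the label of the block that contains it, so blocks with
    distinct labels are disjoint. *)
Lemma uniq_allpairs_by (S T R : eqType) (U : eqType) (F : S -> T -> R) (t : S -> seq T)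
    (g : R -> U) (h : S -> U) (s : seq S) :
  uniq (map h s) -> {in s, forall x, uniq (t x)} ->
  {in s, forall x, {in t x &, injective (F x)}} ->
  {in s, forall x, {in t x, forall y, g (F x y) = h x}} ->
  uniq [seq F x y | x <- s, y <- t x].
Proof.
elim: s => //= x s IH /andP[hx us] ut injF gF; rewrite cat_uniq IH //; first last.
- by move=> z zs; apply: gF; rewrite inE zs orbT.
- by move=> z zs; apply: injF; rewrite inE zs orbT.
- by move=> z zs; apply: ut; rewrite inE zs orbT.
rewrite map_inj_in_uniq ?ut ?mem_head //= ?andbT; last exact/injF/mem_head.
apply/hasPn => _ /allpairsPdep[z [y [zs yt ->]]]; apply: contra hx.
case/mapP => y' y't /(congr1 g); rewrite gF ?inE ?zs ?orbT // gF ?mem_head // => <-.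
exact: map_f.
Qed.

(** A monomial in only one of b, c, d, e is standard for several pairs {y, z}. To count it once, the
    20 cells from [std_edges] are confined to positive exponents of both y and z, and 20 further
    cells hold the remaining monomials. *)
Definition std_cells : seq (nat * nat * (nat * nat)) :=
  std_edges ++ [seq (w, (v, v)) | w <- weights, v <- [:: 1; 2; 3; 4]%N].

(* A cell with y = z holds the single monomial a^k f^l y^n of its degree. *)
Definition cell_expo (m : nat) (s : nat * nat * (nat * nat)) (k : nat) : seq nat :=
  [seq if j == 0 then s.1.1 else if j == 5 then s.1.2 else
       ((j == s.2.1) * k + (j == s.2.2) * (m - s.1.1 - s.1.2 - k))
  | j <- iota 0 6]%N.

Definition cell_range (m : nat) (s : nat * nat * (nat * nat)) : seq nat :=
  iota 1 (if s.2.1 == s.2.2 then 1 else m - s.1.1 - s.1.2 - 1)%N.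

Definition std_list (m : nat) : seq (seq nat) :=
  [seq cell_expo m s k | s <- std_cells, k <- cell_range m s].

(** Each of the first 20 cells has m - deg w - 1 elements, each of the others one, and the degrees
    of the 20 monomials w add up to 20. *)
Lemma size_std_list m : (4 <= m)%N -> size (std_list m) = (20 * m - 20)%N.
Proof.
move=> le4; rewrite size_allpairs_dep.
have -> : [seq size (cell_range m s) | s <- std_cells] =
  [seq (if s.2.1 == s.2.2 then 1 else m - s.1.1 - s.1.2 - 1)%N | s <- std_cells].
  by apply: eq_map => s; rewrite size_iota.
rewrite /=; lia.
Qed.

Lemma std_cellP (P : nat * nat * (nat * nat) -> Prop) :
  (forall j, (j < 40)%N -> P (nth (0, 0, (0, 0))%N std_cells j)) ->
  {in std_cells, forall s, P s}.
Proof. by move=> H s /(nthP (0, 0, (0, 0))%N)[j ltj <-]; apply: H. Qed.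

Lemma uniq_std_list m : (4 <= m)%N -> uniq (std_list m).
Proof.
(* A cell is recognised by the exponents of a and f and by which of b, c, d, e occur. *)
move=> le4; pose g (e : seq nat) :=
  (nth 0 e 0, nth 0 e 5, [seq 0 < nth 0 e j | j <- iota 1 4])%N.
pose h (s : nat * nat * (nat * nat)) :=
  (s.1.1, s.1.2, [seq (j == s.2.1) || (j == s.2.2) | j <- iota 1 4]).
apply: (uniq_allpairs_by (g := g) (h := h)) => //.
- by move=> s _; apply: iota_uniq.
- apply: std_cellP; do 40?[case=> [_ k k'|]];
    [rewrite !mem_iota /= => ltk ltk' []; lia ..| by []].
- apply: std_cellP; do 40?[case=> [_ k|]]; [rewrite mem_iota /= => ltk ..| by []].
  all: rewrite /g /h /=; do ![congr pair]; do ![congr cons]; lia.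
Qed.

Lemma std_list_std m : (4 <= m)%N ->
  {in std_list m, forall e, [/\ size e = 6%N, sumn e = m & std e]}.
Proof.
move=> le4 _ /allpairsPdep[s [k [s_in k_in ->]]]; split; first by rewrite size_map.
- move: s s_in k k_in; apply: std_cellP.
  do 40?[case=> [_ k|]]; [rewrite mem_iota /= => ltk; lia ..| by []].
- move: s s_in k k_in; apply: std_cellP.
  by do 40?[case=> [_ k|]]; [rewrite /std /std_at /cell_expo /= => _; rewrite ?muln0 ?mul0n ?eqxx ?orbT ..| by []].
Qed.

Lemma mem_std_list m e : (4 <= m)%N -> size e = 6%N -> sumn e = m -> std e ->
  e \in std_list m.
Proof.
move=> le4; case: e => [|a [|b [|c [|d [|e [|g []]]]]]] //= _ dege.
case/hasP=> s s_in /and3P[/= /eqP a_ /eqP g_ faces].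
pose y := nth 0%N [:: a; b; c; d; e; g] s.2.1.
pose z := nth 0%N [:: a; b; c; d; e; g] s.2.2.
(* If one exponent is zero, the monomial moves to the cell of the other variable, whose only index
   is 1. Both cannot be zero, because w has degree at most 2 and m is at least 4. *)
pose s' := if y == 0%N then (s.1, (s.2.2, s.2.2)) else
           if z == 0%N then (s.1, (s.2.1, s.2.1)) else s.
pose k := if (y == 0%N) || (z == 0%N) then 1%N else y.
apply/allpairsPdep; exists s', k; rewrite /s' /k /y /z {s' k y z}.
rewrite !inE in s_in; move: s_in faces a_ g_.
by do ![case/orP]; move=> /eqP -> /= /and3P[/eqP ? /eqP ? _] ? ?; subst;
  case: eqP => ?; try (case: eqP => ?);
  (split; [by [] | rewrite mem_iota /=; lia | rewrite /cell_expo /=; do ![congr cons]; lia]).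
Qed.

(** * Reducedness and degree *)

Section LineSchemeIdeal.
Variable K : closedFieldType.
Hypothesis charK0 : [pchar K] =i pred0.
Variables (i gamma : K).
Hypotheses (i2 : i ^+ 2 = -1) (gamma0 : gamma != 0).
Local Notation I := (line_scheme_ideal i gamma).

Lemma homog_mem_of_vanishing m (f : {mpoly K[6]}) : (4 <= m)%N -> f \is m.-homog ->
  (forall p, zero_pt i gamma p -> f.@[p] = 0) -> I f.
Proof.
move=> le4 homf f0; have [g stdg Ifg] := homog_reducible charK0 i2 gamma0 le4 homf.
suff g0 : g = 0 by rewrite g0 subr0 in Ifg.
apply: (std_mpoly_eq0 charK0 i2 gamma0 stdg) => p zp.
by apply/eqP; rewrite -oppr_eq0 -[- _]add0r -{1}(f0 p zp) -mevalB; apply/eqP/zp.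
Qed.

Lemma line_scheme_reduced : proj_reduced I.
Proof.
(* As e > 0, the factor g^4 brings the degree up to at least 4, whatever the degree of f. *)
move=> e g e0 homg k f homf r [N IgN]; exists 4.
apply: (@homog_mem_of_vanishing (e * 4 + k * e)).
- by rewrite (leq_trans _ (leq_addr _ _)) // leq_pmull.
- by apply: dhomogM => //; apply: dhomogMn.
move=> p zp; have := zp _ IgN; rewrite mevalM !rmorphXn /= => /eqP.
rewrite mulf_eq0 !expf_eq0 mevalM rmorphXn /=.
by case/orP=> /andP[_ /eqP ->]; rewrite ?expr0n ?mul0r ?mulr0.
Qed.

Lemma line_scheme_hilbert_value m : (4 <= m)%N -> hilbert_value I m (20 * m - 20).
Proof.
move=> le4; pose X e : dhomog 6 K m := indhomog m 'X_[mnm_of e].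
have XE e : e \in std_list m -> X e = 'X_[mnm_of e] :> {mpoly K[6]}.
  move=> /(std_list_std le4)[sze dege _]; rewrite /X /indhomog insubdK //.
  by rewrite unfold_in -/(_ \is m.-homog) dhomogX -dege; apply/eqP/mdeg_mnm_of.
pose W : {vspace dhomog 6 K m} := <<map X (std_list m)>>%VS.
have stdW w : w \in W -> std_mpoly m w.
  move=> /(@coord_span _ _ _ (in_tuple _)) ->; rewrite raddf_sum /=.
  apply: big_ind => [x|f g stdf stdg x|j _ x]; first by rewrite msupp0.
    by move=> /msuppD_le; rewrite mem_cat => /orP[/stdf|/stdg].
  have ltj : (j < size (std_list m))%N by rewrite -(size_map X).
  have e_in := mem_nth [::] ltj; have [sze dege stde] := std_list_std le4 e_in.
  rewrite (nth_map [::]) // ?linearZ /= XE // => /msuppZ_le.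
  by rewrite msuppX inE => /eqP ->; rewrite mdeg_mnm_of ?mnm_ofK.
have dimW : \dim W = (20 * m - 20)%N.
  suff : free (in_tuple (map X (std_list m))).
    by move=> /eqP /= ->; rewrite size_map size_std_list.
  apply/freeP => c c0 j.
  have lt_list (k : 'I_(size (map X (std_list m)))) : (k < size (std_list m))%N.
    by rewrite -(size_map X).
  pose e k := nth [::] (std_list m) k.
  have := congr1 (fun w : dhomog 6 K m => (w : {mpoly K[6]})@_(mnm_of (e j))) c0.
  rewrite /= mcoeff0 raddf_sum /= raddf_sum /= (bigD1 j) //= big1 => [|k neq_kj].
    rewrite addr0 (nth_map [::]) // mcoeffZ XE ?mem_nth //.
    by rewrite mcoeffX eqxx mulr1.
  rewrite (nth_map [::]) // mcoeffZ XE ?mem_nth // mcoeffX.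
  case: eqP => [ekj|_]; last by rewrite mulr0.
  case/eqP: neq_kj; apply/val_inj/eqP; rewrite /=.
  rewrite -(nth_uniq [::] (lt_list k) (lt_list j) (uniq_std_list le4)).
  have sz k' : size (e (val (k' : 'I_(size (map X (std_list m)))))) = 6%N.
    by have [] := std_list_std le4 (mem_nth [::] (lt_list k')).
  apply/eqP; change (e k = e j).
  by rewrite -(mnm_ofK (sz k)) ekj (mnm_ofK (sz j)).
rewrite -dimW.
apply: (complement_of_normal_forms (P := fun v : dhomog 6 K m => I v) (W := W)).
- exact: ideal_gen0.
- move=> a u v Iu Iv; rewrite linearP /= -mul_mpolyC.
  by apply: ideal_genD Iv; apply: ideal_genMl.
- move=> v; have [g stdg Ivg] := homog_reducible charK0 i2 gamma0 le4 (dhomog_is_dhomog v).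
  exists (\sum_(x <- msupp g) g@_x *: X (expo_of x)).
    rewrite big_seq; apply: memv_suml => x /stdg[degx stdx]; apply: memvZ.
    apply/memv_span/map_f/mem_std_list => //; first exact: size_expo_of.
    by rewrite sumn_expo_of.
  suff gE : \sum_(x <- msupp g) g@_x *: X (expo_of x) = g :> {mpoly K[6]}.
    by rewrite linearB /= gE.
  rewrite raddf_sum /= [RHS]mpolyE; apply: eq_big_seq => x /stdg[degx stdx].
  rewrite ?linearZ /= XE ?expo_ofK //; apply: mem_std_list => //.
    exact: size_expo_of.
  by rewrite sumn_expo_of.
(* An element of I vanishes at the points of the curves by definition of [zero_pt], and a standard
   form vanishing there is zero. *)
- move=> w wW Iw; apply/val_inj/(std_mpoly_eq0 charK0 i2 gamma0 (stdW w wW)) => p zp.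
  exact: zp.
Qed.

Lemma line_scheme_degree : proj_degree I 20.
Proof.
have c0 : (20 : rat) != 0 by [].
exists (20 *: ('X - 1%:P)); split; last first.
  by rewrite lead_coefZ lead_coefXsubC size_scale // size_XsubC /= !mulr1.
exists 4 => m le4; exists (20 * m - 20)%N; split; first exact: line_scheme_hilbert_value.
rewrite hornerZ hornerXsubC natrB; last by rewrite leq_pmulr // (leq_trans _ le4).
by rewrite natrM mulrBr mulr1.
Qed.

End LineSchemeIdeal.

Theorem theorem3p3 (K : closedFieldType) (charK0 : [pchar K] =i pred0)
    (i : K) (i2 : i ^+ 2 = -1) (gamma : K) (gamma_neq0 : gamma != 0) :
  proj_reduced (line_scheme_ideal i gamma) /\
  proj_degree (line_scheme_ideal i gamma) 20.
Proof.
by split; [apply: line_scheme_reduced | apply: line_scheme_degree].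
Qed.
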